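(* Let $E\subseteq[0,1]$ be a Lebesgue measurable set such that $[0,1]\setminus E$ has positive Lebesgue measure. Let $\{u_j\}_{j\in\mathbb{N}}\subseteq L^2(E)$ be a Bessel sequence with Bessel bound $1$. Then there exists an orthonormal system $\{\phi_j\}_{j\in\mathbb{N}}\subseteq L^2([0,1])$ satisfying $$\phi_j|_E=u_j,\qquad \|\phi_j\|_{L^\infty([0,1]\setminus E)}\le\frac{1}{\sqrt{\lambda([0,1]\setminus E)}},\qquad j\in\mathbb{N}.$$ Moreover, the constant $\frac{1}{\sqrt{\lambda([0,1]\setminus E)}}$ is optimal for every such set $E$: for every such $E$, it cannot be replaced by any smaller constant for which the preceding conclusion holds for all Bessel sequences $\{u_j\}_{j\in\mathbb{N}}\subseteq L^2(E)$ with Bessel bound $1$.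
   Context: Here $\lambda$ denotes Lebesgue measure, and $L^2(E)$, $L^2([0,1])$, $L^\infty([0,1]\setminus E)$ are spaces of complex-valued functions with respect to Lebesgue measure (equalities of functions hold almost everywhere). A sequence $\{u_j\}_{j\in\mathbb{N}}$ in a complex Hilbert space is called a Bessel sequence with Bessel bound $1$ if for every $N\in\mathbb{N}$ and all $c_1,\dots,c_N\in\mathbb{C}$ one has $$\Big\|\sum_{j=1}^N c_ju_j\Big\|^2\le\sum_{j=1}^N|c_j|^2.$$ *)

(* Defs.v *)
From HB Require Import structures.
From mathcomp Require Import all_boot all_order all_algebra.
From mathcomp Require Import all_classical all_reals all_analysis.
From mathcomp.real_closed Require Export complex.

Set Implicit Arguments.
Unset Strict Implicit.
Unset Printing Implicit Defensive.

Import Order.TTheory GRing.Theory Num.Theory.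
Import numFieldNormedType.Exports.

Local Open Scope classical_set_scope.
Local Open Scope ring_scope.

(* [lebesgueType R] is convertible to [R], but its measurable sets are the
   Lebesgue measurable ones; the canonical sigma-algebra of [R] is Borel. *)
Notation lebesgueType R := (caratheodory_type (@wlength R idfun)^*%mu).

Notation lambda := completed_lebesgue_measure.

Notation cmod := ComplexField.Normc.normc.

Definition unit_itv (R : realType) : set (lebesgueType R) :=
  [set` `[0 : R, 1 : R]].

Definition cmeasurable_fun (R : realType) (D : set (lebesgueType R))
    (f : lebesgueType R -> R[i]) : Prop :=
  measurable_fun D (fun x => complex.Re (f x)) /\
  measurable_fun D (fun x => complex.Im (f x)).

Definition cintegral (R : realType) (D : set (lebesgueType R))
    (f : lebesgueType R -> R[i]) : R[i] :=
  Complex (\int[lambda]_(x in D) complex.Re (f x))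
          (\int[lambda]_(x in D) complex.Im (f x)).

(* The norm of L^p(D), as the L^p norm over R of |f| extended by 0 outside D.
   For p = +oo this is the essential supremum of |f| over D, since |f| >= 0. *)
Definition Lpnorm (R : realType) (D : set (lebesgueType R)) (p : \bar R)
    (f : lebesgueType R -> R[i]) : \bar R :=
  ('N[lambda]_p [(fun x => (cmod (f x))%:E) \_ D])%E.

(* Elements of L^2(D) are represented by functions on the whole line, of which
   only the values on D matter; equalities of functions on D are stated almost
   everywhere. *)
Definition inL2 (R : realType) (D : set (lebesgueType R))
    (f : lebesgueType R -> R[i]) : Prop :=
  cmeasurable_fun D f /\ (Lpnorm D 2%:E f < +oo)%E.

Definition inner (R : realType) (D : set (lebesgueType R))
    (f g : lebesgueType R -> R[i]) : R[i] :=
  cintegral D (fun x => f x * conjc (g x)).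

Definition orthonormal_system (R : realType) (D : set (lebesgueType R))
    (phi : nat -> lebesgueType R -> R[i]) : Prop :=
  (forall j, inL2 D (phi j)) /\
  (forall j k, inner D (phi j) (phi k) = (j == k)%:R).

Definition bessel1 (R : realType) (D : set (lebesgueType R))
    (u : nat -> lebesgueType R -> R[i]) : Prop :=
  (forall j, inL2 D (u j)) /\
  (forall (N : nat) (c : 'I_N -> R[i]),
    (Lpnorm D 2%:E (fun x => \sum_(j < N) c j * u j x)%R ^+ 2
       <= (\sum_(j < N) cmod (c j) ^+ 2)%R%:E)%E).

Definition completion_with_bound (R : realType) (E : set (lebesgueType R))
    (C : R) : Prop :=
  forall u : nat -> lebesgueType R -> R[i], bessel1 E u ->
    exists phi : nat -> lebesgueType R -> R[i],
      orthonormal_system (@unit_itv R) phi /\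
      (forall j, {ae lambda, forall x, E x -> phi j x = u j x}) /\
      (forall j, (Lpnorm (@unit_itv R `\` E) +oo (phi j) <= C%:E)%E).

(* Main.v *)
Require Import Defs.
From HB Require Import structures.
From mathcomp Require Import all_boot all_order all_algebra.
From mathcomp Require Import all_classical all_reals all_analysis.
From mathcomp Require Import measurable_realfun ess_sup_inf.
From mathcomp Require Import ring lra.

(* Put F = [0,1] \ E, let d be its measure and A = 1 - Gram(u), an infinite matrix
   with 0 <= A <= 1.  One needs functions w_j on F with |w_j| <= 1 and
   (1/d) int_F w_j conj(w_k) = A_jk; then phi_j = w_j / sqrt d on F.

   For finitely many indices write A = f^* f with f : C^r -> C^n a contraction, and
   look for a random vector z with |(z f)_j| <= 1 for all j and E(z^* z) = 1.  Let K
   be the convex hull of the matrices z^* z over such z, let X be the point of K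
   closest to the identity, and suppose that H = 1 - X is not zero.  By induction on
   r, the projection onto the orthogonal complement of any unit vector v is in the
   closure of K, so the variational inequality tr(H Y) <= tr(H X), for Y in K, gives
   v H v^* >= |H|^2 > 0.  So z H z^* is strictly convex, and the inequality extends
   to all z once it is known at the extreme points e; these have at least r
   coordinates of modulus one, and |e|^2 >= |e f|^2 >= r.  This forces tr X >= r,
   that is tr H <= 0, which contradicts the positivity of H.  Almost closest points
   are enough, so that no compactness is needed here.

   For infinitely many indices the values w_j are coded by sequences of bits.  The
   probabilities of finite bit strings under the laws found above converge along an
   ultrafilter, and the limit law on bit sequences is realized on F by successively
   cutting F into pieces of prescribed measure.

   The constant is optimal because u = 0 forces int_F |phi_j|^2 = 1. *)

Set Implicit Arguments.
Unset Strict Implicit.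
Unset Printing Implicit Defensive.

Import Order.TTheory GRing.Theory Num.Theory.
Import numFieldNormedType.Exports.

Local Open Scope classical_set_scope.
Local Open Scope ring_scope.

(** * The real Frobenius form on complex matrices *)

Section ComplexParts.
Local Open Scope complex_scope.
Local Open Scope sesquilinear_scope.
Variable R : realType.
Implicit Types x y : R[i].

Lemma ReD x y : complex.Re (x + y) = complex.Re x + complex.Re y.
Proof. by case: x; case: y. Qed.
Lemma ImD x y : complex.Im (x + y) = complex.Im x + complex.Im y.
Proof. by case: x; case: y. Qed.
Lemma ReM x y : complex.Re (x * y) =
  complex.Re x * complex.Re y - complex.Im x * complex.Im y.
Proof. by case: x; case: y. Qed.
Lemma ImM x y : complex.Im (x * y) =
  complex.Re x * complex.Im y + complex.Im x * complex.Re y.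
Proof. by case: x; case: y. Qed.
Lemma Re_conjC x : complex.Re (x^*)%R = complex.Re x. Proof. by case: x. Qed.
Lemma Im_conjC x : complex.Im (x^*)%R = - complex.Im x. Proof. by case: x. Qed.

Lemma Re_sum I (s : seq I) (P : pred I) (F : I -> R[i]) :
  complex.Re (\sum_(i <- s | P i) F i) = \sum_(i <- s | P i) complex.Re (F i).
Proof. by elim/big_rec2: _ => // i a b _ <-; rewrite ReD. Qed.
Lemma Im_sum I (s : seq I) (P : pred I) (F : I -> R[i]) :
  complex.Im (\sum_(i <- s | P i) F i) = \sum_(i <- s | P i) complex.Im (F i).
Proof. by elim/big_rec2: _ => // i a b _ <-; rewrite ImD. Qed.

End ComplexParts.

Section RealFrobenius.
Local Open Scope complex_scope.
Local Open Scope sesquilinear_scope.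
Variable R : realType.
Local Notation C := R[i].

(** The real Euclidean inner product of matrices read as vectors of real and imaginary parts; the
    closest-point argument takes place in this real space. *)
Definition frob m n (A B : 'M[C]_(m, n)) : R := complex.Re (\tr (A *m B^t*)).

Lemma frobDl m n (A B D : 'M[C]_(m, n)) : frob (A + B) D = frob A D + frob B D.
Proof. by rewrite /frob mulmxDl raddfD ReD. Qed.

Lemma frobZl m n (A D : 'M[C]_(m, n)) (s : R) : frob (s%:C *: A) D = s * frob A D.
Proof. by rewrite /frob -scalemxAl mxtraceZ ReM /= mul0r subr0. Qed.

Lemma frobE m n (A B : 'M[C]_(m, n)) : frob A B =
  \sum_i \sum_j (complex.Re (A i j) * complex.Re (B i j) +
                 complex.Im (A i j) * complex.Im (B i j)).
Proof.
rewrite /frob /mxtrace Re_sum; apply: eq_bigr => i _.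
rewrite mxE Re_sum; apply: eq_bigr => j _.
by rewrite !mxE ReM Re_conjC Im_conjC mulrN opprK.
Qed.

Lemma frobC m n (A B : 'M[C]_(m, n)) : frob A B = frob B A.
Proof.
rewrite !frobE; apply: eq_bigr => i _; apply: eq_bigr => j _.
by rewrite mulrC [X in _ + X]mulrC.
Qed.

Lemma frobDr m n (A B D : 'M[C]_(m, n)) : frob D (A + B) = frob D A + frob D B.
Proof. by rewrite !(frobC D) frobDl. Qed.

Lemma frobZr m n (A D : 'M[C]_(m, n)) (s : R) : frob D (s%:C *: A) = s * frob D A.
Proof. by rewrite !(frobC D) frobZl. Qed.

Lemma frobNl m n (A D : 'M[C]_(m, n)) : frob (- A) D = - frob A D.
Proof. by rewrite /frob mulNmx raddfN /=; case: (\tr _). Qed.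

Lemma frobNr m n (A D : 'M[C]_(m, n)) : frob D (- A) = - frob D A.
Proof. by rewrite !(frobC D) frobNl. Qed.

Lemma frob_ge0 m n (A : 'M[C]_(m, n)) : 0 <= frob A A.
Proof.
rewrite frobE; apply: sumr_ge0 => i _; apply: sumr_ge0 => j _.
by rewrite addr_ge0 // -expr2 sqr_ge0.
Qed.

Lemma frob_gt0 m n (A : 'M[C]_(m, n)) : A != 0 -> 0 < frob A A.
Proof.
move=> A0; rewrite lt_neqAle frob_ge0 andbT eq_sym; apply: contra A0 => /eqP.
have h i j : 0 <= complex.Re (A i j) * complex.Re (A i j) +
                 complex.Im (A i j) * complex.Im (A i j).
  by rewrite addr_ge0 // -expr2 sqr_ge0.
rewrite frobE => /psumr_eq0P A0; apply/eqP/matrixP => i j; rewrite mxE.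
have /psumr_eq0P := A0 (fun i _ => sumr_ge0 _ (fun j _ => h i j)) i isT.
move=> /(_ (fun k _ => h i k) j isT)/eqP.
rewrite -!expr2 paddr_eq0 ?sqr_ge0// !sqrf_eq0.
by case: (A i j) => a b /= /andP[/eqP-> /eqP->].
Qed.

(** Expand the square of [t A - B] and divide by [t]. The free weight [t] lets a small factor offset
    a large one, in place of Cauchy-Schwarz. *)
Lemma frob_young m n (A B : 'M[C]_(m, n)) (t : R) : 0 < t ->
  2 * frob A B <= t * frob A A + frob B B / t.
Proof.
move=> t0.
have := frob_ge0 (t%:C *: A - B).
rewrite !(frobDl, frobDr, frobNl, frobNr, frobZl, frobZr) (frobC B A) => h.
rewrite -(ler_pM2l t0) [leRHS]mulrDr [t * (_ / t)]mulrCA divff ?gt_eqF// mulr1.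
by lra.
Qed.

Lemma frob_isometry r k (J : 'M[C]_(k, r)) (D : 'M[C]_k) :
  J *m J^t* = 1%:M -> frob (J^t* *m D *m J) (J^t* *m D *m J) = frob D D.
Proof.
move=> JJ; rewrite /frob !trmx_mul !map_mxM /= trmxCK.
rewrite !mulmxA -(mulmxA (J^t* *m D)) JJ mulmx1.
by rewrite -!mulmxA mxtrace_mulC -!mulmxA JJ mulmx1.
Qed.

(** Vectors are rows, so this is a rank-one matrix, and [frob G (outer z)] is the real part of the
    quadratic form z G z^* of [G]. *)
Definition outer n (z : 'rV[C]_n) : 'M[C]_n := z^t* *m z.

Lemma outerE n (z : 'rV[C]_n) i j : outer z i j = (z 0 i)^* * z 0 j.
Proof. by rewrite /outer mxE big_ord1 !mxE. Qed.

Lemma frob1_outer n (z : 'rV[C]_n) : frob 1%:M (outer z) = frob z z.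
Proof.
by rewrite /frob mul1mx /outer trmx_mul map_mxM /= trmxCK mxtrace_mulC.
Qed.

Lemma frob_outer n (z : 'rV[C]_n) : frob (outer z) (outer z) = frob z z ^+ 2.
Proof.
rewrite /frob /outer trmx_mul map_mxM /= trmxCK mulmxA -(mulmxA _ z) mxtrace_mulC.
rewrite !mulmxA -mulmxA /mxtrace !big_ord1 mxE big_ord1.
set x := (z *m z^t*) 0 0.
have : complex.Im x = 0.
  rewrite /x mxE Im_sum big1 // => i _.
  by rewrite !mxE ImM Re_conjC Im_conjC mulrN mulrC addNr.
by case: x => a b /= ->; rewrite mulr0 subr0.
Qed.

Lemma outer_line n (z v : 'rV[C]_n) (s : R) :
  outer (z + s%:C *: v) =
  outer z + s%:C *: (z^t* *m v + v^t* *m z) + (s ^+ 2)%:C *: outer v.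
Proof.
have -> : outer (z + s%:C *: v) = (z^t* + s%:C *: v^t*) *m (z + s%:C *: v).
  congr (_ *m _); apply/matrixP => i j; rewrite !mxE rmorphD rmorphM /=.
  by congr (_ + _ * _); exact: conjc_real.
rewrite /outer mulmxDl !mulmxDr -!scalemxAl -!scalemxAr scalerA scalerDr !addrA.
by rewrite rmorphXn /= expr2.
Qed.

Lemma outerZ n (v : 'rV[C]_n) (s : R) : outer (s%:C *: v) = (s ^+ 2)%:C *: outer v.
Proof.
apply/matrixP => i j; rewrite [RHS]mxE !outerE !mxE rmorphM mulrACA rmorphXn /= expr2.
by congr (_ * _ * _); exact: conjc_real.
Qed.

Lemma outer_mul m n (z : 'rV[C]_m) (J : 'M[C]_(m, n)) :
  outer (z *m J) = J^t* *m outer z *m J.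
Proof. by rewrite /outer trmx_mul map_mxM /= !mulmxA. Qed.

Definition csq (x : C) : R := complex.Re x ^+ 2 + complex.Im x ^+ 2.

Lemma csq_ge0 x : 0 <= csq x. Proof. by rewrite addr_ge0 ?sqr_ge0. Qed.

Lemma frob_row n (z : 'rV[C]_n) : frob z z = \sum_j csq (z 0 j).
Proof. by rewrite frobE big_ord1. Qed.

Lemma csqN x : csq (- x) = csq x.
Proof. by case: x => a b; rewrite /csq /= !sqrrN. Qed.

Lemma csq_conj (x : C) : csq (x^*)%R = csq x.
Proof. by case: x => a b; rewrite /csq /= sqrrN. Qed.

Lemma csqZ (s : R) x : csq (s%:C * x) = s ^+ 2 * csq x.
Proof. by case: x => a b; rewrite /csq /=; ring. Qed.

Lemma frob_delta n (k : 'I_n) : frob (delta_mx 0 k : 'rV[C]_n) (delta_mx 0 k) = 1.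
Proof.
rewrite frob_row (bigD1 k) //= big1 => [|j jk].
  by rewrite mxE !eqxx /csq /= expr1n expr0n !addr0.
by rewrite mxE (negbTE jk) /csq /= expr0n addr0.
Qed.

Lemma frob_mulmx_isometry r n (J : 'M[C]_(r, n)) (z : 'rV[C]_r) :
  J *m J^t* = 1%:M -> frob (z *m J) (z *m J) = frob z z.
Proof.
by move=> JJ; rewrite /frob trmx_mul map_mxM /= mulmxA -(mulmxA z) JJ mulmx1.
Qed.

Lemma sum_outer_delta n : \sum_(k < n) outer (delta_mx 0 k) = 1%:M :> 'M[C]_n.
Proof.
apply/matrixP => i j; rewrite summxE !mxE.
under eq_bigr => k _ do rewrite outerE !mxE !eqxx /=.
rewrite (bigD1 i) //= big1 => [|k ki]; last first.
  by rewrite [i == k]eq_sym (negbTE ki) rmorph0 mul0r.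
by rewrite eqxx rmorph1 mul1r addr0 eq_sym.
Qed.

End RealFrobenius.

(** * Matrices [z^* z] with [z] in a slice of the polydisc *)

(* The exit time of a ray from a region cut out by convex quadratic inequalities. *)
Lemma quadratic_exit (R : rcfType) (I : finType) (a b c : I -> R) (i0 : I) :
  (forall i, 0 <= a i) -> (forall i, a i = 0 -> b i = 0) ->
  (forall i, c i <= 0) -> (forall i, 0 < a i -> c i < 0) -> 0 < a i0 ->
  exists s : R, [/\ 0 <= s,
    forall i, c i + 2 * s * b i + s ^+ 2 * a i <= 0 &
    exists2 i, 0 < a i & c i + 2 * s * b i + s ^+ 2 * a i = 0].
Proof.
move=> a0 ab c0 ac ai0.
(* The larger root of the quadratic in [s]. When [a i > 0] the sign of [c i] makes the discriminant
   exceed [b i ^+ 2], so this root is nonnegative. *)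
pose root i : R := (Num.sqrt (b i ^+ 2 - a i * c i) - b i) / a i.
have discr i : 0 < a i -> b i ^+ 2 < b i ^+ 2 - a i * c i.
  by move=> ai; rewrite ltrDl oppr_gt0 pmulr_rlt0 // ac.
have sqroot i : 0 < a i -> `|b i| < Num.sqrt (b i ^+ 2 - a i * c i).
  move=> ai; rewrite -sqrtr_sqr ltr_sqrt ?discr //.
  by apply: le_lt_trans (discr _ ai); exact: sqr_ge0.
have root0 i : 0 < a i -> 0 <= root i.
  move=> ai; apply: divr_ge0; last exact: ltW.
  by rewrite subr_ge0 ltW // (le_lt_trans (ler_norm _)) // sqroot.
have rootE i : 0 < a i -> c i + 2 * root i * b i + root i ^+ 2 * a i = 0.
  move=> ai; have ane : a i != 0 by rewrite gt_eqF.
  have D0 : 0 <= b i ^+ 2 - a i * c i.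
    by apply: le_trans (ltW (discr _ ai)); exact: sqr_ge0.
  have := sqr_sqrtr D0; rewrite /root.
  set q := Num.sqrt _ => qE; apply: (mulfI ane); rewrite mulr0.
  transitivity (q ^+ 2 - (b i ^+ 2 - a i * c i)); first by field.
  by rewrite qE subrr.
have le_root i (s : R) : 0 < a i -> 0 <= s <= root i ->
    c i + 2 * s * b i + s ^+ 2 * a i <= 0.
  move=> ai /andP[s0 sr]; have := rootE i ai; have r0 := root0 i ai.
  set r := root i in sr r0 * => hr.
  have [rE|rn0] := eqVneq r 0.
    have -> : s = 0 by apply/eqP; rewrite eq_le s0 andbT -rE.
    by rewrite expr0n !mulr0 !mul0r !addr0.
  have rp : 0 < r by rewrite lt_neqAle eq_sym rn0.
  rewrite -(pmulr_rle0 _ rp).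
  (* Convexity made explicit: the value at [s] is expressed by the value at the root [r], which is
     zero, and a nonpositive remainder. *)
  have -> : r * (c i + 2 * s * b i + s ^+ 2 * a i) =
      s * (c i + 2 * r * b i + r ^+ 2 * a i) + (r - s) * (c i - s * r * a i).
    by ring.
  rewrite hr mulr0 add0r mulr_ge0_le0 ?subr_ge0 // subr_le0.
  rewrite (le_trans (c0 i)) //.
  by apply: mulr_ge0 (a0 i); exact: mulr_ge0.
(* The ray leaves the region at the smallest of the roots. *)
pose i1 := [arg min_(i < i0 | 0 < a i) root i]%O.
have [ai1 mini1] : 0 < a i1 /\ forall i, 0 < a i -> root i1 <= root i.
  by rewrite /i1; case: arg_minP.
exists (root i1); split; first exact: root0.
  move=> i; have [ai|] := ltP 0 (a i).
    by apply: le_root => //; rewrite root0 //= mini1.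
  move=> ai; have {}ai : a i = 0 by apply/eqP; rewrite eq_le ai a0.
  by rewrite ai (ab _ ai) !mulr0 !addr0.
by exists i1 => //; exact: rootE.
Qed.

Section Polydisc.
Local Open Scope complex_scope.
Local Open Scope sesquilinear_scope.
Variable R : realType.
Local Notation C := R[i].

Definition contractive r n (f : 'M[C]_(r, n)) :=
  forall z : 'rV[C]_r, frob (z *m f) (z *m f) <= frob z z.

(* Bounding [frob z z] by [r] keeps the set bounded even if [f] has a kernel. *)
Definition slice r n (f : 'M[C]_(r, n)) (z : 'rV[C]_r) : Prop :=
  frob z z <= r%:R /\ forall j, csq ((z *m f) 0 j) <= 1.

(** Binary combinations make statements about the hull provable by induction; [outer_hull_sum]
    recovers an explicit finite combination. *)
Inductive outer_hull r (S : 'rV[C]_r -> Prop) : 'M[C]_r -> Prop :=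
| outer_hull1 z : S z -> outer_hull S (outer z)
| outer_hull_conv t X Y : 0 <= t <= 1 -> outer_hull S X -> outer_hull S Y ->
    outer_hull S ((1 - t)%:C *: X + t%:C *: Y).

Lemma outer_hull_frob_le r (S : 'rV[C]_r -> Prop) (G : 'M[C]_r) (b : R) :
  (forall z, S z -> frob G (outer z) <= b) ->
  forall X, outer_hull S X -> frob G X <= b.
Proof.
move=> Sb X; elim=> [z /Sb //|t Y Z /andP[t0 t1] _ hY _ hZ].
rewrite frobDr !frobZr.
have := ler_wpM2l t0 hZ; have := ler_wpM2l (_ : 0 <= 1 - t) hY.
by rewrite subr_ge0 => /(_ t1); lra.
Qed.

Lemma frob_le_sqr m n (A B : 'M[C]_(m, n)) (b : R) :
  frob A A <= b -> frob B B <= b -> frob A B <= b.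
Proof.
by move=> hA hB; have := frob_young A B ltr01; rewrite mul1r divr1; lra.
Qed.

Lemma outer_hull_bounded r n (f : 'M[C]_(r, n)) X :
  outer_hull (slice f) X -> frob X X <= r%:R ^+ 2.
Proof.
elim=> [z [zr _]|t Y Z /andP[t0 t1] _ hY _ hZ].
  by rewrite frob_outer ler_sqr ?nnegrE ?frob_ge0.
rewrite !(frobDr, frobDl, frobZl, frobZr) (frobC Z Y).
have hYZ := frob_le_sqr hY hZ.
have t1' : 0 <= 1 - t by rewrite subr_ge0.
have := ler_wpM2l (mulr_ge0 t0 t0) hZ.
have := ler_wpM2l (mulr_ge0 t1' t0) hYZ.
have := ler_wpM2l (mulr_ge0 t1' t1') hY.
by nra.
Qed.

(* Moving along a direction that does not change the coordinates of modulus one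
   can be continued until another coordinate reaches modulus one; this stops
   only with [r] such coordinates, or with [frob e e = r]. *)
Lemma slice_extreme r n (f : 'M[C]_(r, n)) (G : 'M[C]_r) (z : 'rV[C]_r) :
  contractive f -> (forall v, 0 <= frob G (outer v)) -> slice f z ->
  exists e, [/\ slice f e, frob e e = r%:R &
                frob G (outer z) <= frob G (outer e)].
Proof.
move=> fle G0.
pose tight (x : 'rV[C]_r) := [set j : 'I_n | csq ((x *m f) 0 j) == 1]%SET.
(* Induction on the number of coordinates of modulus less than one. *)
have [k] := ubnP #|~: tight z|%SET.
elim: k z => // k IHk z; rewrite ltnS => zk [zr zf].
have [zrE|zrN] := eqVneq (frob z z) r%:R; first by exists z.
have zr' : frob z z < r%:R by rewrite lt_neqAle zrN zr.
set T := tight z.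
(* By contractivity, [r] tight coordinates would force [frob z z] to be at least [r]. *)
have Tr : (#|T| < r)%N.
  rewrite ltnNge; apply: contraTN zr' => rT; rewrite -leNgt.
  apply: le_trans (fle z); rewrite frob_row (bigID (mem T)) /=.
  rewrite -[leLHS]addr0 lerD ?sumr_ge0 // => [|j _]; last exact: csq_ge0.
  rewrite (eq_bigr (fun=> 1)) => [|j]; last by rewrite inE => /eqP.
  by rewrite sumr_const ler_nat.
(* Fewer than [r] columns of [f] are tight, so some nonzero row [v] is annihilated by all of
   them. *)
have [v v0 vT] : exists2 v : 'rV[C]_r, v != 0 &
    forall j, j \in T -> (v *m f) 0 j = 0.
  pose g : 'M[C]_(r, #|T|) := colsub (@enum_val _ (mem T)) f.
  have /rowV0Pn[v /sub_kermxP vg v0] : kermx g != 0.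
    by rewrite -mxrank_eq0 mxrank_ker subn_eq0 -ltnNge (leq_ltn_trans (rank_leq_col _)).
  exists v => // j jT; have /rowP/(_ (enum_rank_in jT j)) := vg.
  rewrite [RHS]mxE => h; rewrite -[RHS]h !mxE; apply: eq_bigr => i _.
  by rewrite mxE enum_rankK_in.
(* Replacing [v] by [- v] makes the first-order change of [frob G (outer z)] nonnegative; the
   second-order change is nonnegative because the form of [G] is. *)
wlog vz : v v0 vT / 0 <= frob G (z^t* *m v + v^t* *m z).
  move=> H; have [|/ltW h] := leP 0 (frob G (z^t* *m v + v^t* *m z)); first exact: H.
  apply: (H (- v)); rewrite ?oppr_eq0 //.
    by move=> j jT; rewrite mulNmx mxE vT // oppr0.
  have -> : z^t* *m - v + (- v)^t* *m z = - (z^t* *m v + v^t* *m z).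
    rewrite mulmxN opprD; congr (_ + _); rewrite -mulNmx; congr (_ *m _).
    by apply/matrixP => i j; rewrite !mxE rmorphN.
  by rewrite frobNr oppr_ge0.
(* One quadratic constraint for each coordinate and, at [None], the norm constraint, whose leading
   coefficient is positive and so forces an exit. *)
pose a (i : option 'I_n) : R := if i is Some j then csq ((v *m f) 0 j) else frob v v.
pose b (i : option 'I_n) : R := if i is Some j
  then complex.Re ((z *m f) 0 j) * complex.Re ((v *m f) 0 j) +
       complex.Im ((z *m f) 0 j) * complex.Im ((v *m f) 0 j)
  else frob z v.
pose c (i : option 'I_n) : R := if i is Some j then csq ((z *m f) 0 j) - 1
  else frob z z - r%:R.
have csq_eq0 (x : C) : csq x = 0 -> x = 0.
  move/eqP; rewrite /csq paddr_eq0 ?sqr_ge0 // !sqrf_eq0.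
  by case: x => x y /= /andP[/eqP -> /eqP ->].
have [||||| s [s0 sle [i ai si]]] := @quadratic_exit R _ a b c None.
- by case=> [j|]; [exact: csq_ge0 | exact: frob_ge0].
- case=> [j /csq_eq0 /= ->|/= /eqP]; first by rewrite !mulr0 addr0.
  by rewrite gt_eqF // frob_gt0.
- by case=> [j|] /=; rewrite subr_le0.
- case=> [j|] /= vj; rewrite subr_lt0 // lt_neqAle zf andbT.
  by apply: contraTN vj => zj; rewrite vT ?inE // /csq /= expr0n addr0 ltxx.
- exact: frob_gt0.
have qnorm : frob (z + s%:C *: v) (z + s%:C *: v) - r%:R =
    c None + 2 * s * b None + s ^+ 2 * a None.
  by rewrite /= !(frobDl, frobDr, frobZl, frobZr) (frobC v z); ring.
have lineE j : ((z + s%:C *: v) *m f) 0 j = (z *m f) 0 j + s%:C * (v *m f) 0 j.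
  by rewrite mulmxDl -scalemxAl [LHS]mxE; congr (_ + _); rewrite [LHS]mxE.
have qcoord j : csq (((z + s%:C *: v) *m f) 0 j) - 1 =
    c (Some j) + 2 * s * b (Some j) + s ^+ 2 * a (Some j).
  rewrite /= lineE /csq.
  by case: ((z *m f) 0 j) => x1 y1; case: ((v *m f) 0 j) => x2 y2 /=; ring.
set z' := z + s%:C *: v in qnorm qcoord.
have fz' : slice f z'.
  by split=> [|j]; rewrite -subr_le0 ?qnorm ?qcoord.
have Gz' : frob G (outer z) <= frob G (outer z').
  rewrite outer_line 2!frobDr !frobZr -addrA lerDl.
  by rewrite addr_ge0 // mulr_ge0 // sqr_ge0.
(* Exit through the norm constraint ends the search; exit through coordinate [j] adds a tight
   coordinate, since [v] does not move those already tight. *)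
case: i ai si => [j aj sj|_ sn]; last first.
  by exists z'; split => //; apply/eqP; rewrite -subr_eq0 qnorm sn.
have [|e [fe er Ge]] := IHk z' _ fz'; last by exists e; split => //; exact: le_trans Ge.
apply: leq_trans zk; apply: proper_card; rewrite properE; apply/andP; split.
  apply/fintype.subsetP => l; rewrite !inE; apply: contra => lT.
  by rewrite /z' lineE vT ?inE // mulr0 addr0.
apply/fintype.subsetPn; exists j; rewrite !inE.
  by apply: contraTN aj => jT; rewrite /= vT ?inE // /csq /= expr0n addr0 ltxx.
by rewrite negbK -subr_eq0 qcoord sj.
Qed.

Lemma slice0 r n (f : 'M[C]_(r, n)) : slice f 0.
Proof.
split=> [|j]; first by rewrite frob_row big1 // => j _; rewrite mxE /csq /= expr0n addr0.
by rewrite mul0mx mxE /csq /= expr0n addr0.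
Qed.

(** First variation at an approximate minimizer: moving from [X] towards [Y] by a fraction [t]
    cannot lower the squared distance to [P] by more than the slack [t * d]. *)
Lemma outer_hull_almost_closest r n (f : 'M[C]_(r, n)) (P : 'M[C]_r) (d : R) :
  0 < d -> exists2 X, outer_hull (slice f) X &
    forall Y, outer_hull (slice f) Y -> frob (P - X) (Y - X) <= d.
Proof.
move=> d0.
pose D := [set frob (P - X) (P - X) | X in [set X | outer_hull (slice f) X]].
have infD : has_inf D.
  split; last by exists 0 => _ [X _ <-]; exact: frob_ge0.
  exists (frob (P - outer 0) (P - outer 0)); exists (outer 0) => //.
  by apply: outer_hull1; exact: slice0.
(* By the parallelogram law [B] bounds the squared distance between two points of the hull; the
   choice of [t] then makes the quadratic term [t ^+ 2 * B] at most [t * d]. *)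
pose B : R := 4 * r%:R ^+ 2 + 1.
have B0 : 0 < B by rewrite /B ltr_wpDl // mulr_ge0 // sqr_ge0.
pose t := Num.min 1 (d / B).
have t0 : 0 < t by rewrite lt_min ltr01 divr_gt0.
have t1 : t <= 1 by rewrite ge_min lexx.
have tB : t * B <= d by rewrite -ler_pdivlMr // ge_min lexx orbT.
have [_ [X hX <-] Xinf] := inf_adherent (mulr_gt0 t0 d0) infD.
exists X => // Y hY.
have : inf D <= frob (P - X - t%:C *: (Y - X)) (P - X - t%:C *: (Y - X)).
  apply: (ge_inf infD.2); exists ((1 - t)%:C *: X + t%:C *: Y).
    by apply: outer_hull_conv => //; rewrite (ltW t0) t1.
  congr (frob _ _);
    by rewrite rmorphB rmorph1 scalerBl scale1r scalerBr !opprD !opprK !addrA [RHS]addrAC.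
have : frob (Y - X) (Y - X) <= B.
  have := outer_hull_bounded hX; have := outer_hull_bounded hY.
  have := frob_ge0 (Y + X); rewrite /B.
  by rewrite !(frobDl, frobDr, frobNl, frobNr) (frobC X Y); lra.
move: Xinf; move: (P - X) (Y - X) => H Z Xinf ZB.
rewrite !(frobDl, frobDr, frobNl, frobNr, frobZl, frobZr) (frobC Z H) => h.
have {}ZB := ler_wpM2l (mulr_ge0 (ltW t0) (ltW t0)) ZB.
have tB' := ler_wpM2l (ltW t0) tB.
rewrite -(ler_pM2l t0); lra.
Qed.

Lemma mulmx_row_conj n (z : 'rV[C]_n) : z *m z^t* = (frob z z)%:C%:M.
Proof.
apply/rowP => i; rewrite ord1 frob_row !mxE eqxx mulr1n rmorph_sum.
apply: eq_bigr => j _; rewrite !mxE -normCK normc_def -rmorphXn /=.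
by rewrite sqr_sqrtr // csq_ge0.
Qed.

(** The rows of [J] are a Gram-Schmidt basis of the orthogonal complement of [v]. Placing [v] on top
    of them gives a square matrix, whose one-sided inverse is two-sided, and this yields the second
    identity. *)
Lemma unit_complement r (v : 'rV[C]_r.+1) : frob v v = 1 ->
  exists2 J : 'M[C]_(r, r.+1), J *m J^t* = 1%:M & J^t* *m J = 1%:M - outer v.
Proof.
move=> fv1; have v1 : v *m v^t* = 1%:M by rewrite mulmx_row_conj fv1.
have vU : v \is unitarymx by apply/unitarymxP.
have [k kr [J JJ Jv]] : exists2 k, k = r &
    exists2 J : 'M[C]_(k, r.+1), J *m J^t* = 1%:M & J *m v^t* = 0.
  pose K := kermx (v^t*).
  have rk : \rank K = r by rewrite mxrank_ker mxrank_map mxrank_tr mxrank_unitary // subn1.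
  exists (\rank K) => //; exists (schmidt (row_base K)).
    by apply/unitarymxP; rewrite schmidt_unitarymx // rank_leq_col.
  apply/sub_kermxP; rewrite -/K.
  by rewrite (eqmx_schmidt_free (row_base_free K)) eq_row_base.
subst k; exists J => //.
have vJ : v *m J^t* = 0.
  rewrite -[LHS]trmxCK trmx_mul map_mxM /= trmxCK Jv.
  by apply/matrixP => i j; rewrite !mxE rmorph0.
have M1 : (col_mx v J : 'M[C]_(1 + r)) *m (col_mx v J)^t* = 1%:M.
  by rewrite tr_col_mx map_row_mx mul_col_row v1 vJ Jv JJ -scalar_mx_block.
have := mulmx1C M1; rewrite tr_col_mx map_row_mx mul_row_col => <-.
by rewrite addrC addKr.
Qed.

Theorem identity_outer_hull r n (f : 'M[C]_(r, n)) (eps : R) :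
  contractive f -> 0 < eps ->
  exists2 X, outer_hull (slice f) X & frob (1%:M - X) (1%:M - X) < eps.
Proof.
elim: r n f eps => [|r IHr] n f eps fle e0.
  exists (outer 0); first by apply: outer_hull1; exact: slice0.
  by rewrite frobE big_ord0.
apply: contrapT => /forall2NP noX.
have far X : outer_hull (slice f) X -> eps <= frob (1%:M - X) (1%:M - X).
  by move=> hX; have [//|/negP] := noX X; rewrite -leNgt.
(* The bound [eps / 4] keeps [c >= eps / 2] below, and [eps ^+ 2 / 8] serves the final
   contradiction. *)
pose d := Num.min (eps / 4) (eps ^+ 2 / 8).
have d0 : 0 < d by rewrite lt_min !divr_gt0 // exprn_gt0.
have [X hX Xmin] := outer_hull_almost_closest f 1%:M d0.
have Hfar := far _ hX.
have [H HE] : exists H, H = 1%:M - X by exists (1%:M - X).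
rewrite -HE in Xmin Hfar.
have {}HE : 1%:M = H + X by rewrite HE subrK.
have HX Y : outer_hull (slice f) Y -> frob H Y <= frob H X + d.
  by move=> /Xmin; rewrite frobDr frobNr lerBlDl.
pose c := eps - 2 * d.
have c0 : eps / 2 <= c.
  have : d <= eps / 4 by rewrite ge_min lexx.
  by rewrite /c; lra.
have c0' : 0 < c by apply: lt_le_trans c0; rewrite divr_gt0.
have H1 : frob H 1%:M = frob H H + frob H X by rewrite HE frobDr.
(* By induction the projection [1 - outer v] is almost in the hull. *)
have Hunit (v : 'rV[C]_r.+1) : frob v v = 1 -> c <= frob H (outer v).
  move=> v1; have [J JJ JtJ] := unit_complement v1.
  have isoJ (z : 'rV[C]_r) : frob (z *m J) (z *m J) = frob z z.
    exact: frob_mulmx_isometry.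
  have fle' : contractive (J *m f).
    by move=> z; rewrite mulmxA -(isoJ z); exact: fle.
  (* In [frob_young] this weight gives at most [d] for the term in [H] and, with the accuracy
     [t * d] of the induction, at most [d] for the other term. *)
  pose t := d / (frob H H + 1).
  have HH1 : 0 < frob H H + 1 by rewrite ltr_wpDl // frob_ge0.
  have t0 : 0 < t by rewrite divr_gt0.
  have [Y hY Yt] := IHr n (J *m f) (t * d) fle' (mulr_gt0 t0 d0).
  have hJY : outer_hull (slice f) (J^t* *m Y *m J).
    elim: hY => [z [zr zf]|s Y1' Y2 s01 _ h1 _ h2].
      rewrite -outer_mul; apply: outer_hull1; split.
        by rewrite isoJ (le_trans zr) // ler_nat.
      by move=> j; rewrite -mulmxA.
    rewrite mulmxDr mulmxDl -!scalemxAr -!scalemxAl.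
    exact: outer_hull_conv.
  have := HX _ hJY.
  have : 2 * frob H (J^t* *m (1%:M - Y) *m J) <= d + d.
    apply: le_trans (frob_young _ _ t0) _; apply: lerD.
      by rewrite /t mulrAC ler_pdivrMr // ler_pM2l // lerDl.
    by rewrite frob_isometry // ler_pdivrMr // mulrC ltW.
  rewrite mulmxBr mulmxBl mulmx1 JtJ !frobDr !frobNr H1.
  by move: Hfar; rewrite /c; clear; lra.
(* By scaling, the bound on unit vectors says that [H - c] is a nonnegative form, as [slice_extreme]
   demands. *)
have psd (v : 'rV[C]_r.+1) : 0 <= frob (H - c%:C *: 1%:M) (outer v).
  have [->|v0] := eqVneq v 0.
    by rewrite frobC /frob /outer mulmx0 mul0mx linear0.
  have n0 := frob_gt0 v0.
  pose a := Num.sqrt (frob v v).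
  have a2 : a^-1 ^+ 2 = (frob v v)^-1 by rewrite exprVn sqr_sqrtr // ltW.
  have : c <= frob H (outer (a^-1%:C *: v)).
    apply: Hunit; rewrite frobZl frobZr mulrA -expr2 a2 mulVf //.
    by rewrite gt_eqF.
  rewrite outerZ frobZr a2 ler_pdivlMl // frobDl frobNl frobZl frob1_outer.
  by rewrite subr_ge0 mulrC.
(* At an extreme point the squared norm is exactly [r.+1], so the multiple of the identity
   contributes the constant [c * r.+1]. *)
have key z : slice f z ->
    frob (H - c%:C *: 1%:M) (outer z) <= frob H X + d - c * r.+1%:R.
  move=> /(slice_extreme fle psd)[e [fe er Ge]]; apply: le_trans Ge _.
  rewrite frobDl frobNl frobZl frob1_outer er lerD2r.
  by apply: HX; exact: outer_hull1.
have {}key := outer_hull_frob_le key hX.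
have tr1 : frob (1%:M : 'M[C]_r.+1) 1%:M = r.+1%:R.
  by rewrite /frob mul1mx trmx1 map_mx1 mxtrace1 -(rmorph_nat (real_complex R)).
have trH : c * r.+1%:R <= frob H 1%:M.
  rewrite -(sum_outer_delta R) [leRHS](_ : _ = \sum_(k < r.+1) frob H (outer (delta_mx 0 k))).
    rewrite mulr_natr -[in leLHS](card_ord r.+1) -sumr_const; apply: ler_sum => k _.
    by apply: Hunit; exact: frob_delta.
  elim/big_rec2: _ => [|k x A _ <-]; last by rewrite frobDr.
  by rewrite frobC /frob mul0mx linear0.
move: key; rewrite frobDl frobNl frobZl => key.
have : frob H 1%:M = r.+1%:R - frob 1%:M X.
  by rewrite -tr1 [in X in _ = frob _ X - _]HE frobDr addrK frobC.
have r1 : 1 <= r.+1%:R :> R by rewrite ler1n.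
have : d <= eps ^+ 2 / 8 by rewrite ge_min lexx orbT.
have : eps / 2 * (eps / 2) <= c * c.
  by apply: ler_pM => //; rewrite divr_ge0 // ltW.
(* The bounds combine to c^2 (r + 1) <= c tr H <= d <= eps^2 / 8, against c^2 >= eps^2 / 4. *)
by move: trH key r1 e0 d0 c0 c0'; clear; nra.
Qed.

End Polydisc.

(** * Finite laws with a prescribed Gram matrix *)

Section DiscreteLaws.
Local Open Scope complex_scope.
Local Open Scope sesquilinear_scope.
Variable R : realType.
Local Notation C := R[i].

Lemma frob_rows m n (M : 'M[C]_(m, n)) : frob M M = \sum_i frob (row i M) (row i M).
Proof.
rewrite frobE; apply: eq_bigr => i _; rewrite frob_row; apply: eq_bigr => j _.
by rewrite mxE -!expr2.
Qed.

Lemma frob_adj m n (A B : 'M[C]_(m, n)) : frob (A^t*) (B^t*) = frob A B.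
Proof.
rewrite !frobE exchange_big; apply: eq_bigr => i _; apply: eq_bigr => j _.
by rewrite !mxE !Re_conjC !Im_conjC mulrNN.
Qed.

Lemma frob_mulmx_le k r n (f : 'M[C]_(r, n)) (M : 'M[C]_(k, r)) :
  contractive f -> frob (M *m f) (M *m f) <= frob M M.
Proof.
move=> fle; rewrite !frob_rows; apply: ler_sum => i _.
by rewrite row_mul; exact: fle.
Qed.

Lemma frob_conj_mulmx_le r n (f : 'M[C]_(r, n)) (M : 'M[C]_r) :
  contractive f -> frob (f^t* *m M *m f) (f^t* *m M *m f) <= frob M M.
Proof.
move=> fle; apply: le_trans (frob_mulmx_le _ fle) _.
rewrite -frob_adj trmx_mul map_mxM /= trmxCK -[leRHS]frob_adj.
exact: frob_mulmx_le.
Qed.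

Lemma frob_entry_le m n (M : 'M[C]_(m, n)) i j : csq (M i j) <= frob M M.
Proof.
rewrite frobE (bigD1 i) //= (bigD1 j) //= -addrA -!expr2 lerDl.
by rewrite addr_ge0 ?sumr_ge0 // => k _; rewrite ?sumr_ge0 // => *;
  rewrite addr_ge0 // -expr2 sqr_ge0.
Qed.

(** From the spectral form A = P^* d P take f = sqrt(d) P; testing the hypothesis on the rows of [P]
    puts the eigenvalues in [0, 1]. *)
Lemma contraction_factor n (A : 'M[C]_n) : A^t* = A ->
  (forall z : 'rV[C]_n, 0 <= complex.Re ((z *m A *m z^t*) 0 0) <= frob z z) ->
  exists2 f : 'M[C]_n, A = f^t* *m f & contractive f.
Proof.
move=> Aherm Abnd.
have Ah : A \is hermsymmx.
  by apply/is_hermitianmxP; rewrite expr0 scale1r.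
have := hermitian_spectral_diag_real Ah.
have /orthomx_spectralP := hermitian_normalmx Ah.
have := spectral_unitarymx A.
move: (spectralmx A) (spectral_diag A) => P d PU.
rewrite invmx_unitary // => AE dreal.
have /unitarymxP PP := PU.
pose e k := complex.Re (d 0 k).
have dE k : d 0 k = (e k)%:C.
  by rewrite RRe_real //; move/mxOverP: dreal; exact.
have e01 k : 0 <= e k <= 1.
  have := Abnd (delta_mx 0 k *m P).
  rewrite frob_mulmx_isometry // frob_delta AE trmx_mul map_mxM /= !mulmxA.
  rewrite -(mulmxA (delta_mx 0 k)) PP mulmx1 -(mulmxA (_ *m diag_mx d)) PP mulmx1.
  by rewrite -rowE trmx_delta map_delta_mx -colE !mxE eqxx mulr1n.
pose D : 'M[C]_n := diag_mx (\row_k (Num.sqrt (e k))%:C).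
have DD : D^t* = D.
  apply/matrixP => i j; rewrite !mxE eq_sym rmorphMn.
  by case: eqVneq => [->|_]; [exact: conjc_real | rewrite !mulr0n].
have DDd : D *m D = diag_mx d.
  rewrite mulmx_diag; congr diag_mx; apply/rowP => j.
  rewrite !mxE dE -rmorphM -expr2 sqr_sqrtr //.
  by case/andP: (e01 j).
exists (D *m P).
  by rewrite trmx_mul map_mxM /= DD AE -DDd !mulmxA.
move=> z; rewrite mulmxA frob_mulmx_isometry // !frob_row; apply: ler_sum => j _.
rewrite mul_mx_diag !mxE mulrC csqZ ler_piMl ?csq_ge0 //.
by case/andP: (e01 j) => e0 e1; rewrite sqr_sqrtr.
Qed.

Lemma outer_hull_sum r (S : 'rV[C]_r -> Prop) X : outer_hull S X ->
  exists (I : finType) (p : I -> R) (z : I -> 'rV[C]_r),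
  [/\ forall i, 0 <= p i, \sum_i p i = 1, forall i, S (z i) &
      X = \sum_i (p i)%:C *: outer (z i)].
Proof.
elim=> [z Sz|t Y Z /andP[t0 t1] _ [I [p [y [p0 p1 Sy ->]]]] _ [J [q [z [q0 q1 Sz ->]]]]].
  exists unit, (fun=> 1), (fun=> z); split => //; rewrite big_const card_unit /=.
    by rewrite addr0.
  by rewrite rmorph1 scale1r addr0.
exists (I + J)%type.
exists (fun x => match x with inl i => (1 - t) * p i | inr j => t * q j end).
exists (fun x => match x with inl i => y i | inr j => z j end).
split.
- by case=> [i|j]; rewrite mulr_ge0 // subr_ge0.
- by rewrite big_sumType /= -!mulr_sumr p1 q1 !mulr1 subrK.
- by case.
rewrite big_sumType /= !scaler_sumr; congr (_ + _); apply: eq_bigr => i _.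
  by rewrite scalerA -rmorphM.
by rewrite scalerA -rmorphM.
Qed.

(** Factor 1 - Gram, up to conjugation, as f^* f, and take a law of [z] whose second moment [X] is
    close to the identity. Then [w = z f] has second moment f^* X f, which is close to f^* f because
    [f] is contractive. *)
Lemma gram_discrete_law (g : nat -> nat -> C) (n : nat) (eps : R) :
  (forall j k, g k j = (g j k)^*) ->
  (forall c : 'I_n -> C, 0 <= complex.Re (\sum_j \sum_k c j * (c k)^* * g j k)
     <= \sum_j csq (c j)) ->
  0 < eps ->
  exists (I : finType) (p : I -> R) (w : I -> nat -> C),
  [/\ forall i, 0 <= p i, \sum_i p i = 1, forall i j, csq (w i j) <= 1 &
    forall j k, (j < n)%N -> (k < n)%N ->
      csq (\sum_i (p i)%:C * (w i j * (w i k)^*) - ((j == k)%:R - g j k)) < eps].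
Proof.
move=> gherm gbnd e0.
(* [outer] conjugates the left factor while the Gram matrix conjugates the right one, hence the
   conjugate of [g]. *)
pose A : 'M[C]_n := \matrix_(j, k) ((j == k)%:R - (g j k)^*).
have [||f Af fle] := @contraction_factor n A.
- apply/matrixP => j k; rewrite !mxE rmorphB rmorph_nat eq_sym.
  by rewrite (gherm j k); congr (_ - _); exact: conjcK.
- move=> z.
  have -> : complex.Re ((z *m A *m z^t*) 0 0) =
      frob z z - complex.Re (\sum_j \sum_k (z 0 j)^* * z 0 k * g j k).
    rewrite frob_row mxE !Re_sum -sumrB; apply: eq_bigr => k _.
    rewrite !mxE mulr_suml.
    rewrite (eq_bigr (fun j => (j == k)%:R * z 0 j * (z 0 k)^* -
        z 0 j * (z 0 k)^* * g k j)); last first.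
      by move=> j _; rewrite !mxE (gherm j k) mulrBr mulrBl (mulrC (z 0 j) _%:R) (mulrAC (z 0 j)).
    rewrite sumrB (bigD1 k) //= big1 => [|j /negPf ->]; last by rewrite !mul0r.
    rewrite eqxx mul1r addr0 ReD; congr (_ + _).
      by case: (z 0 k) => x y /=; rewrite /csq /= mulrN opprK -!expr2.
    rewrite raddfN /=; congr (- complex.Re _); apply: eq_bigr => j _.
    by rewrite (mulrC (z 0 j)).
  have := gbnd (fun k => (z 0 k)^*).
  have -> : \sum_j csq (z 0 j)^* = frob z z.
    by rewrite frob_row; apply: eq_bigr => j _; rewrite csq_conj.
  rewrite (eq_bigr (fun j => \sum_k (z 0 j)^* * z 0 k * g j k)); last first.
    move=> j _; apply: eq_bigr => k _; congr (_ * _ * _); exact: conjcK.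
  by rewrite subr_ge0 lerBlDr lerDl => /andP[-> ->].
have [X hX Xe] := identity_outer_hull fle e0.
have [I [p [z [p0 p1 Sz XE]]]] := outer_hull_sum hX.
(* Coordinates from [n] on get the default 0, which keeps the bound by one for every [j]. *)
exists I, p, (fun i j => if insub j is Some k then (z i *m f) 0 k else 0).
split => //.
  move=> i j; case: insubP => [k _ _|_]; first exact: (Sz i).2.
  by rewrite /csq /= expr0n addr0.
move=> j k jn kn; rewrite !insubT.
apply: le_lt_trans Xe; apply: le_trans (frob_conj_mulmx_le _ fle).
set M := (X in frob X X).
have := frob_entry_le M (Ordinal jn) (Ordinal kn); rewrite /M => /(le_trans _); apply.
rewrite mulmxBr mulmxBl mulmx1 -Af XE mulmx_sumr mulmx_suml.
rewrite le_eqVlt; apply/orP; left; apply/eqP.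
rewrite -[LHS]csqN -[LHS]csq_conj; congr csq.
have mxB (P Q : 'M[C]_n) u v : (P - Q) u v = P u v - Q u v.
  by rewrite mxE [X in _ + X]mxE.
rewrite mxB opprB rmorphB rmorphB rmorph_nat summxE rmorph_sum.
congr (_ - _); first by rewrite mxE.
apply: eq_bigr => i _.
rewrite -scalemxAr -scalemxAl -outer_mul [RHS]mxE outerE !rmorphM.
congr (_ * _); first exact: conjc_real.
by congr (_ * _); exact: conjcK.
Qed.

End DiscreteLaws.

(** * Cutting a set into pieces of prescribed measure *)

(* Bit strings list the last bit first. *)
Fixpoint prefix_bits (b : nat -> bool) (m : nat) : seq bool :=
  if m is k.+1 then b k :: prefix_bits b k else [::].

Lemma size_prefix_bits b m : size (prefix_bits b m) = m.
Proof. by elim: m => //= m ->. Qed.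

Lemma nth_prefix_bits b m i : (i < m)%N ->
  nth false (prefix_bits b m) (m.-1 - i) = b i.
Proof.
elim: m => // m IH; rewrite ltnS leq_eqVlt => /predU1P[->|im]; first by rewrite subnn.
have -> : (m.+1.-1 - i = (m.-1 - i).+1)%N by case: m im {IH} => // m im; rewrite -subSn.
exact: IH.
Qed.

Section Cells.
Context d (T : measurableType d) (R : realType) (mu : {measure set T -> \bar R}).

(** Nonatomicity in intermediate-value form, demanded of all measurable subsets so that cutting can
    be repeated. *)
Definition divisible (F : set T) := forall A, measurable A -> A `<=` F ->
  forall q : R, 0 <= q -> (q%:E <= mu A)%E ->
  exists B, [/\ measurable B, B `<=` A & mu B = q%:E].

Variables (F : set T) (delta : R) (P : seq bool -> R).
Hypotheses (mF : measurable F) (muF : mu F = delta%:E) (divF : divisible F).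
Hypotheses (delta0 : 0 < delta) (P0 : forall s, 0 <= P s) (P1 : P [::] = 1).
Hypothesis (Pcons : forall s, P s = P (false :: s) + P (true :: s)).

Let part (A : set T) (q : R) : set T :=
  get [set B | [/\ measurable B, B `<=` A & mu B = q%:E]].

(** Meant as the set of points whose first bits form [s]; since strings are reversed, the parent
    cell belongs to the tail. *)
Fixpoint cell (s : seq bool) : set T :=
  if s is b :: s' then
    let B := part (cell s') (P (false :: s') * delta) in
    if b then cell s' `\` B else B
  else F.

Let partP s : measurable (cell s) -> cell s `<=` F ->
  mu (cell s) = (P s * delta)%:E ->
  [/\ measurable (cell (false :: s)), cell (false :: s) `<=` cell s &
      mu (cell (false :: s)) = (P (false :: s) * delta)%:E].
Proof.
move=> mC CF muC; have q0 := mulr_ge0 (P0 (false :: s)) (ltW delta0).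
have qC : ((P (false :: s) * delta)%:E <= mu (cell s))%E.
  by rewrite muC lee_fin ler_pM2r // [leRHS]Pcons lerDl.
exact: getPex (divF mC CF q0 qC).
Qed.

Lemma cellP s :
  [/\ measurable (cell s), cell s `<=` F & mu (cell s) = (P s * delta)%:E].
Proof.
elim: s => [|b s [mC CF muC]]; first by rewrite P1 mul1r; split.
have [mB BC muB] := partP mC CF muC.
case: b; last by split => //; exact: subset_trans CF.
split; [exact: measurableD|by move=> x [/CF]|].
have muoo : (mu (cell s) < +oo)%E by rewrite muC ltry.
have muD : mu (cell s `\` cell (false :: s)) = (mu (cell s) - mu (cell (false :: s)))%E.
  by rewrite [LHS](measureD mC mB muoo) (setIidr BC).
rewrite [LHS]muD muC muB -EFinB [P s]Pcons; congr (_%:E); ring.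
Qed.

(** The address of a point in the tree of cells. Points outside [F] get an address too, hence the
    intersection with [F] in [cellE]. *)
Fixpoint path_bits (x : T) (m : nat) : seq bool :=
  if m is k.+1 then
    (x \notin cell (false :: path_bits x k)) :: path_bits x k else [::].

Definition bit (i : nat) (x : T) : bool := x \notin cell (false :: path_bits x i).

Lemma prefix_bit x m : prefix_bits (bit^~ x) m = path_bits x m.
Proof. by elim: m => //= m ->. Qed.

Lemma cellE s : cell s = F `&` [set x | prefix_bits (bit^~ x) (size s) = s].
Proof.
elim: s => [|b s IH]; first by apply/seteqP; split=> x //= [].
have BC : cell (false :: s) `<=` cell s.
  by have [mC CF muC] := cellP s; have [] := partP mC CF muC.
apply/seteqP; split=> x.
  move=> Cx; have Cs : cell s x.
    by case: b Cx => [[]|/BC].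
  move: (Cs); rewrite {1}IH => -[Fx /= sE]; split => //=.
  rewrite sE /bit; rewrite prefix_bit in sE; rewrite sE; congr cons.
  case: b Cx => [[_ /= nx]|Cx]; first by apply/negP => /set_mem.
  by apply/negbTE; rewrite negbK; exact/mem_set.
move=> [Fx /= [bE sE]].
have Cs : cell s x by rewrite IH.
move: bE; rewrite /bit; rewrite prefix_bit in sE; rewrite sE.
case: b => [/negP nx|/negbFE/set_mem//]; split => // nx'; apply: nx; exact/mem_set.
Qed.

End Cells.

(** * Limits of random bits *)

(** By compactness of [[a, b]] the image ultrafilter clusters at some [l], and an ultrafilter
    converges to its cluster points. *)
Lemma ultra_bounded_cvg (R : realType) (U : set_system nat) (u : nat -> R) (a b : R) :
  UltraFilter U -> (forall n, a <= u n <= b) -> exists2 l, a <= l <= b & u @ U --> l.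
Proof.
move=> UU uab.
have UP : ProperFilter (u @ U) by exact: fmap_proper_filter.
have [|l [lab cl]] := @segment_compact R a b (u @ U) _.
  by apply: (@filterE _ U _ (u @^-1` [set` `[a, b]])) => n; rewrite /= in_itv /=; exact: uab.
exists l; first by rewrite /= in_itv in lab.
move=> A Al; have [//|nA] := in_ultra_setVsetC (u @^-1` A) UU.
by have [x [nAx Ax]] := cl (~` A) A nA Al.
Qed.

Lemma Rintegral_sum d (T : measurableType d) (R : realType)
    (mu : {measure set T -> \bar R}) (F : set T) (I : Type) (s : seq I)
    (f : I -> T -> R) :
  measurable F -> (forall i, mu.-integrable F (EFin \o f i)) ->
  \int[mu]_(x in F) (\sum_(i <- s) f i x) = \sum_(i <- s) \int[mu]_(x in F) f i x.
Proof.
move=> mF fi; elim: s => [|i s IH].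
  rewrite big_nil; under eq_Rintegral do rewrite big_nil.
  by rewrite Rintegral_cst // mul0r.
rewrite big_cons -IH; under eq_Rintegral do rewrite big_cons.
rewrite RintegralD //.
rewrite (_ : EFin \o _ = (fun x => \sum_(j <- s) (f j x)%:E)%E); last first.
  by apply/funext => x /=; rewrite sumEFin.
by apply: integrable_sum => // j _; exact: fi.
Qed.

(** * Integrals of functions of finitely many bits *)

Section CylinderIntegral.
Context d (T : measurableType d) (R : realType) (mu : {measure set T -> \bar R}).
Variables (F : set T) (delta : R) (P : seq bool -> R) (b : nat -> T -> bool).
Hypotheses (mF : measurable F) (muF : mu F = delta%:E).
Let C s : set T := F `&` [set x | prefix_bits (b^~ x) (size s) = s].
Hypothesis CP : forall s, measurable (C s) /\ mu (C s) = (P s * delta)%:E.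

Let muFoo : (mu F < +oo)%E. Proof. by rewrite muF ltry. Qed.

Lemma bounded_integrable_fin (f : T -> R) (B : R) :
  measurable_fun F f -> (forall x, F x -> `|f x| <= B) ->
  mu.-integrable F (EFin \o f).
Proof.
move=> mf fB; apply: measurable_bounded_integrable => //.
by exists B; split; [exact: num_real|move=> M BM x Fx; exact: le_trans (fB _ Fx) (ltW BM)].
Qed.

Lemma Rintegral_bound (f g : T -> R) (B e : R) :
  measurable_fun F f -> (forall x, F x -> `|f x| <= B) ->
  measurable_fun F g -> (forall x, F x -> `|g x| <= B) ->
  (forall x, F x -> `|f x - g x| <= e) ->
  `|\int[mu]_(x in F) f x - \int[mu]_(x in F) g x| <= e * delta.
Proof.
move=> mf fB mg gB fge.
have if_ := bounded_integrable_fin mf fB; have ig := bounded_integrable_fin mg gB.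
have mfg : measurable_fun F (fun x => f x - g x) by exact: measurable_funB.
have ifg := bounded_integrable_fin mfg fge.
rewrite -RintegralB //; apply: le_trans (le_normr_Rintegral mF ifg) _.
have -> : e * delta = \int[mu]_(x in F) e by rewrite Rintegral_cst // muF.
apply: le_Rintegral => //.
- apply: (@bounded_integrable_fin _ e) => [|x Fx]; last by rewrite normr_id fge.
  exact: measurableT_comp.
- by apply: (@bounded_integrable_fin _ `|e|) => // x.
Qed.

Lemma cylinder_funE M (phi : seq bool -> R) x : F x ->
  phi (prefix_bits (b^~ x) M) = \sum_(s : M.-tuple bool) phi s * \1_(C s) x.
Proof.
move=> Fx.
have sz : size (prefix_bits (b^~ x) M) == M by rewrite size_prefix_bits.
rewrite (bigD1 (Tuple sz)) //= big1 => [|s sN].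
  by rewrite indicE mem_set ?mulr1 ?addr0 // /C /= size_prefix_bits.
rewrite indicE memNset ?mulr0 // => -[_ /=]; rewrite size_tuple => sE.
by move/eqP: sN; apply; apply: val_inj; rewrite /= sE.
Qed.

Lemma measurable_cylinder M (phi : seq bool -> R) :
  measurable_fun F (fun x => phi (prefix_bits (b^~ x) M)).
Proof.
apply: (eq_measurable_fun (fun x => \sum_(s : M.-tuple bool) phi s * \1_(C s) x)).
  by move=> x /set_mem Fx; rewrite (cylinder_funE _ _ Fx).
apply: measurable_sum => s; apply: measurable_funM => //.
by apply: measurable_indic; case: (CP s).
Qed.

Lemma integral_cylinder M (phi : seq bool -> R) :
  \int[mu]_(x in F) phi (prefix_bits (b^~ x) M) =
  delta * \sum_(s : M.-tuple bool) P s * phi s.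
Proof.
rewrite (@eq_Rintegral _ _ _ _ F
  (fun x => \sum_(s : M.-tuple bool) phi s * \1_(C s) x)); last first.
  by move=> x /set_mem Fx; rewrite (cylinder_funE _ _ Fx).
have int1 (s : M.-tuple bool) : mu.-integrable F (EFin \o \1_(C s)).
  apply: (@bounded_integrable_fin _ 1) => [|x _].
    by apply: measurable_indic; case: (CP s).
  by rewrite indicE normr_nat lern1 leq_b1.
rewrite Rintegral_sum // => [|s]; last first.
  exact: (integrableZl mF (phi s) (int1 s)).
rewrite mulr_sumr; apply: eq_bigr => s _.
rewrite RintegralZl // /Rintegral integral_indic //; last by case: (CP s).
rewrite setIidl; last by move=> x [].
have [_ ->] := CP s; rewrite /=; ring.
Qed.

End CylinderIntegral.

(** These are the continuous functions on the Cantor space of bit sequences; their expectations are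
    determined by the probabilities of finite prefixes. *)
Definition cylindrical (R : realType) (Phi : (nat -> bool) -> R) :=
  (exists B, forall b, `|Phi b| <= B) /\
  forall e : R, 0 < e -> exists M (phi : seq bool -> R),
    forall b, `|Phi b - phi (prefix_bits b M)| <= e.

(** Limits along an ultrafilter give consistent prefix probabilities [P], which the cells realize on
    [F]. The ultrafilter refines [\oo], so expectations that converge keep their limits. *)
Theorem random_bits_limit d (T : measurableType d) (R : realType)
    (mu : {measure set T -> \bar R}) (F : set T) (delta : R)
    (I : nat -> finType) (p : forall n, I n -> R) (X : forall n, I n -> nat -> bool) :
  measurable F -> mu F = delta%:E -> divisible mu F -> 0 < delta ->
  (forall n i, 0 <= p n i) -> (forall n, \sum_i p n i = 1) ->
  exists b : nat -> T -> bool, forall Phi, cylindrical Phi ->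
    measurable_fun F (fun x => Phi (b^~ x)) /\
    forall c, (\sum_(i : I n) p n i * Phi (X n i)) @[n --> \oo] --> c ->
      \int[mu]_(x in F) Phi (b^~ x) = delta * c.
Proof.
move=> mF muF divF delta0 p0 p1.
have [U [UU sU]] := @ultraFilterLemma nat \oo _.
pose Pn n (s : seq bool) : R :=
  \sum_(i : I n) p n i * (prefix_bits (X n i) (size s) == s)%:R.
have Pn01 s n : 0 <= Pn n s <= 1.
  apply/andP; split; first by apply: sumr_ge0 => i _; rewrite mulr_ge0.
  by rewrite -(p1 n); apply: ler_sum => i _; rewrite ler_piMr // lern1 leq_b1.
pose P s := sval (cid2 (ultra_bounded_cvg UU (Pn01 s))).
have PU s : Pn^~ s @ U --> P s by rewrite /P; case: cid2.
have P0 s : 0 <= P s by rewrite /P; case: cid2 => l /= lab _; case/andP: lab.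
have unicity (u : nat -> R) (k l : R) : u @ U --> k -> u @ U --> l -> k = l.
  by move=> uk ul; apply: (cvg_unique _ uk ul).
have P1 : P [::] = 1.
  apply: (unicity _ _ _ (PU [::])); rewrite (_ : Pn^~ [::] = cst 1); first exact: cvg_cst.
  apply/funext => n; rewrite /Pn -[RHS](p1 n); apply: eq_bigr => i _.
  by rewrite eqxx mulr1.
have Pcons s : P s = P (false :: s) + P (true :: s).
  apply: (unicity _ _ _ (PU s)).
  rewrite (_ : Pn^~ s = (fun n => Pn n (false :: s) + Pn n (true :: s))); first exact: cvgD.
  apply/funext => n; rewrite /Pn -big_split /=; apply: eq_bigr => i _.
  rewrite !eqseq_cons -mulrDr; congr (_ * _).
  by case: (X n i _) => /=; rewrite ?addr0 ?add0r.
pose b := bit mu F delta P; exists b => Phi [[B PhiB] PhiA].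
have CP s : measurable (F `&` [set x | prefix_bits (b^~ x) (size s) = s]) /\
    mu (F `&` [set x | prefix_bits (b^~ x) (size s) = s]) = (P s * delta)%:E.
  rewrite -(cellE mF muF divF delta0 P0 P1 Pcons).
  by have [] := cellP mF muF divF delta0 P0 P1 Pcons s.
(* A pointwise limit of functions of finitely many bits, taken with accuracy [1 / n.+1]. *)
have mPhi : measurable_fun F (fun x => Phi (b^~ x)).
  have inv0 n : 0 < (n.+1%:R : R)^-1 by rewrite invr_gt0.
  have [M /choice[phi phiE]] := choice (fun n => PhiA _ (inv0 n)).
  apply: (measurable_fun_cvg (h := fun n x => phi n (prefix_bits (b^~ x) (M n)))).
    by move=> n; exact: (measurable_cylinder CP).
  move=> x Fx; apply/cvgrPdist_le => /= e e0; near=> n.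
  apply: le_trans (phiE n (b^~ x)) _; apply: ltW; near: n.
  exact: (near_infty_natSinv_lt (PosNum e0)).
split=> // c cvgc.
apply/eqP; rewrite -subr_eq0 -normr_le0; apply/ler_addgt0Pr => e e0; rewrite add0r.
(* Half of [e] pays for replacing [Phi] by [phi] under the integral and half for doing so in the
   limit of expectations; both errors get multiplied by [delta]. *)
have e'0 : 0 < e / 2 / delta by rewrite !divr_gt0.
have [M [phi phiE]] := PhiA _ e'0.
have cP : `|c - \sum_(s : M.-tuple bool) P s * phi s| <= e / 2 / delta.
  have E1 : (\sum_(i : I n) p n i * Phi (X n i)) @[n --> U] --> c.
    by move=> A /cvgc /sU.
  have E2 : (\sum_(s : M.-tuple bool) Pn n s * phi s) @[n --> U] -->
      \sum_(s : M.-tuple bool) P s * phi s.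
    by apply: cvg_big => [|s _]; [exact: add_continuous | apply: cvgMl; exact: PU].
  have E3 : (\sum_(i : I n) p n i * Phi (X n i) -
      \sum_(s : M.-tuple bool) Pn n s * phi s) @[n --> U] -->
      c - \sum_(s : M.-tuple bool) P s * phi s by exact: cvgB E1 E2.
  apply: (cvgr_to_le (cvg_norm E3)); apply: nearW => n /=.
  (* The outcomes are grouped by their prefix of length [M]. *)
  have -> : \sum_(s : M.-tuple bool) Pn n s * phi s =
      \sum_(i : I n) p n i * phi (prefix_bits (X n i) M).
    under eq_bigr do rewrite mulr_suml.
    rewrite exchange_big; apply: eq_bigr => i _ /=.
    have sz : size (prefix_bits (X n i) M) == M by rewrite size_prefix_bits.
    rewrite (bigD1 (Tuple sz)) //= big1 => [|s sN].
      by rewrite size_prefix_bits eqxx mulr1 addr0.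
    rewrite size_tuple; case: eqVneq => [sE|]; last by rewrite mulr0 mul0r.
    by move/eqP: sN; case; apply: val_inj; rewrite /= sE.
  rewrite -sumrB; apply: le_trans (ler_norm_sum _ _ _) _.
  rewrite -[leRHS]mul1r -[X in _ <= X * _](p1 n) mulr_suml; apply: ler_sum => i _.
  by rewrite -mulrBr normrM (ger0_norm (p0 _ _)); apply: ler_wpM2l; [exact: p0|exact: phiE].
have intP : `|\int[mu]_(x in F) Phi (b^~ x) -
    delta * \sum_(s : M.-tuple bool) P s * phi s| <= e / 2.
  rewrite -(integral_cylinder mF muF CP).
  have -> : e / 2 = e / 2 / delta * delta by rewrite divfK // gt_eqF.
  apply: (@Rintegral_bound _ _ _ _ _ _ mF muF _ _ (B + e / 2 / delta)) => //.
  - by move=> x _; apply: le_trans (PhiB _) _; rewrite lerDl ltW.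
  - exact: (measurable_cylinder CP).
  - move=> x _; have := phiE (b^~ x); have := PhiB (b^~ x).
    have := ler_normD (phi (prefix_bits (b^~ x) M) - Phi (b^~ x)) (Phi (b^~ x)).
    by rewrite subrK distrC; lra.
have := ler_distD (delta * \sum_(s : M.-tuple bool) P s * phi s)
  (\int[mu]_(x in F) Phi (b^~ x)) (delta * c).
move=> h; apply: (le_trans h); rewrite [leRHS]splitr; apply: lerD => //.
rewrite -mulrBr normrM gtr0_norm // distrC -ler_pdivlMl // mulrC.
exact: cP.
Unshelve. all: by end_near. Qed.

(** * Binary coding *)

Section Cylindrical.
Variable R : realType.
Implicit Types Phi Psi : (nat -> bool) -> R.

Lemma drop_prefix_bits b M N : (M <= N)%N ->
  drop (N - M) (prefix_bits b N) = prefix_bits b M.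
Proof.
elim: N => [|N IH]; first by rewrite leqn0 => /eqP ->.
rewrite leq_eqVlt => /predU1P[->|]; first by rewrite subnn drop0.
by rewrite ltnS => MN; rewrite subSn //= IH.
Qed.

(** Longer prefixes determine shorter ones, so two functions can be approximated with a common
    length. *)
Lemma cylindricalP Phi : cylindrical Phi -> forall e : R, 0 < e ->
  exists M0, forall M, (M0 <= M)%N -> exists phi : seq bool -> R,
    forall b, `|Phi b - phi (prefix_bits b M)| <= e.
Proof.
move=> [_ h] e /h[M0 [phi Hphi]]; exists M0 => M MM.
by exists (fun s => phi (drop (M - M0) s)) => b; rewrite drop_prefix_bits.
Qed.

Lemma cylindrical_cst (c : R) : cylindrical (fun=> c).
Proof.
split; first by exists `|c|.
by move=> e e0; exists 0, (fun=> c) => b; rewrite subrr normr0 ltW.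
Qed.

Lemma cylindricalD Phi Psi : cylindrical Phi -> cylindrical Psi ->
  cylindrical (fun b => Phi b + Psi b).
Proof.
move=> cP cQ; split.
  have [[B hB] _] := cP; have [[D hD] _] := cQ.
  by exists (B + D) => b; apply: le_trans (ler_normD _ _) _; exact: lerD.
move=> e e0; have e2 : 0 < e / 2 by rewrite divr_gt0.
have [M hM] := cylindricalP cP e2; have [N hN] := cylindricalP cQ e2.
have [phi hphi] := hM _ (leq_maxl M N); have [psi hpsi] := hN _ (leq_maxr M N).
exists (maxn M N), (fun s => phi s + psi s) => b.
rewrite opprD addrACA [leRHS]splitr.
by apply: le_trans (ler_normD _ _) _; exact: lerD.
Qed.

Lemma cylindricalM Phi Psi : cylindrical Phi -> cylindrical Psi ->
  cylindrical (fun b => Phi b * Psi b).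
Proof.
move=> cP cQ; have [[B hB] _] := cP; have [[D hD] _] := cQ.
have B0 : 0 <= B := le_trans (normr_ge0 _) (hB xpredT).
have D0 : 0 <= D := le_trans (normr_ge0 _) (hD xpredT).
split.
  by exists (B * D) => b; rewrite normrM ler_pM.
(* With [r <= 1] the product of the two errors is at most [r], so the total error is at most
   [r * (B + D + 1)]. *)
move=> e e0; pose r := Num.min 1 (e / (B + D + 1)).
have BD0 : 0 < B + D + 1 by rewrite ltr_wpDl // addr_ge0.
have r0 : 0 < r by rewrite lt_min ltr01 divr_gt0.
have r1 : r <= 1 by rewrite ge_min lexx.
have re : r * (B + D + 1) <= e by rewrite -ler_pdivlMr // ge_min lexx orbT.
have [M hM] := cylindricalP cP r0; have [N hN] := cylindricalP cQ r0.
have [phi hphi] := hM _ (leq_maxl M N); have [psi hpsi] := hN _ (leq_maxr M N).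
exists (maxn M N), (fun s => phi s * psi s) => b; set s := prefix_bits _ _.
have -> : Phi b * Psi b - phi s * psi s =
    (Phi b - phi s) * Psi b + (Phi b * (Psi b - psi s) -
    (Phi b - phi s) * (Psi b - psi s)) by ring.
apply: le_trans re; have -> : r * (B + D + 1) = r * D + (B * r + r * 1) by ring.
apply: le_trans (ler_normD _ _) _; apply: lerD; first by rewrite normrM ler_pM.
apply: le_trans (ler_normB _ _) _; apply: lerD; first by rewrite normrM ler_pM.
by rewrite normrM ler_pM // (le_trans _ r1).
Qed.

Lemma cylindrical_max0 Phi : cylindrical Phi ->
  cylindrical (fun b => Num.max 0 (Phi b)).
Proof.
have lip (x y : R) : `|Num.max 0 x - Num.max 0 y| <= `|x - y|.
  have [x0|x0] := leP 0 x; have [y0|y0] := leP 0 y => //.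
  - rewrite subr0 ger0_norm // ger0_norm; lra.
  - rewrite sub0r normrN ger0_norm // distrC ger0_norm; lra.
  - by rewrite subr0 normr0.
move=> [[B hB] h]; split.
  exists B => b; have := lip (Phi b) 0.
  by rewrite maxxx !subr0 => /le_trans; apply.
move=> e /h[M [phi hphi]]; exists M, (fun s => Num.max 0 (phi s)) => b.
exact: le_trans (lip _ _) _.
Qed.

Lemma exp2V_small (e : R) : 0 < e -> exists K, (2 ^+ K)^-1 <= e.
Proof.
move=> e0; have [K _ /(_ K (leqnn K)) Ke] := near_infty_natSinv_lt (PosNum e0).
exists K; apply: le_trans (ltW Ke).
by rewrite lef_pV2 ?posrE ?exprn_gt0 // -natrX ler_nat ltn_expl.
Qed.

Definition binary_sum (b : nat -> bool) (K : nat) : R :=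
  \sum_(0 <= k < K) (b k)%:R / 2 ^+ k.+1.

Lemma binary_sumS b K : binary_sum b K.+1 = binary_sum b K + (b K)%:R / 2 ^+ K.+1.
Proof. by rewrite /binary_sum big_nat_recr. Qed.

Lemma binary_sum_nd b : nondecreasing_seq (binary_sum b).
Proof.
by apply/nondecreasing_seqP => K; rewrite binary_sumS lerDl divr_ge0 // exprn_ge0.
Qed.

(** Each digit adds at most half of the error term, which is halved at the same time. *)
Lemma binary_sum_tail b K L : (K <= L)%N ->
  binary_sum b L + (2 ^+ L)^-1 <= binary_sum b K + (2 ^+ K)^-1.
Proof.
move=> /subnK <-; elim: (L - K)%N => // m IH; apply: le_trans IH.
rewrite addSn binary_sumS -addrA lerD2l exprS.
have : 0 <= (2 ^+ (m + K))^-1 :> R by rewrite invr_ge0 exprn_ge0.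
rewrite invfM mulrA; case: (b _) => /=; lra.
Qed.

Definition binary_value (b : nat -> bool) : R := limn (binary_sum b).

Lemma binary_sum_cvg b : binary_sum b @ \oo --> binary_value b.
Proof.
apply: nondecreasing_is_cvgn; first exact: binary_sum_nd.
exists 1 => _ [K _ <-]; have := binary_sum_tail b (leq0n K).
rewrite {2}/binary_sum big_geq // add0r expr0 invr1; apply: le_trans.
by rewrite lerDl invr_ge0 exprn_ge0.
Qed.

Lemma binary_value_bounds b K :
  binary_sum b K <= binary_value b <= binary_sum b K + (2 ^+ K)^-1.
Proof.
apply/andP; split; first by apply: nondecreasing_cvgn_le;
  [exact: binary_sum_nd | exact/cvgP/binary_sum_cvg].
apply: (cvgr_to_le (@binary_sum_cvg b)); near=> L.
have KL : (K <= L)%N by near: L; exists K.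
apply: le_trans (binary_sum_tail b KL).
by rewrite lerDl invr_ge0 exprn_ge0.
Unshelve. all: by end_near. Qed.

(** This is [2 ^+ k] times what the first [k] digits leave of [t]. The closed interval [0, 1] is
    preserved: 1 is expanded with all digits equal to one. *)
Fixpoint binary_rest (t : R) (k : nat) : R :=
  if k is j.+1 then 2 * binary_rest t j - (1 <= 2 * binary_rest t j)%R%:R else t.

Definition binary_digit (t : R) (k : nat) : bool := 1 <= 2 * binary_rest t k.

Lemma binary_value_digit t : 0 <= t <= 1 -> binary_value (binary_digit t) = t.
Proof.
move=> t01.
have rest01 k : 0 <= binary_rest t k <= 1.
  by elim: k => //= k /andP[? ?]; case: (leP 1 (2 * _)) => ? /=; apply/andP; split; lra.
have sumE K : binary_sum (binary_digit t) K = t - binary_rest t K / 2 ^+ K.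
  elim: K => [|K IH]; first by rewrite /binary_sum big_geq // expr0 divr1 subrr.
  rewrite binary_sumS IH /= -/(binary_digit t K) exprS.
  have : (2 ^+ K : R) != 0 by rewrite expf_neq0.
  by move=> ?; field.
have near K : `|binary_value (binary_digit t) - t| <= (2 ^+ K)^-1.
  have := binary_value_bounds (binary_digit t) K; have := rest01 K.
  have : 0 <= (2 ^+ K)^-1 :> R by rewrite invr_ge0 exprn_ge0.
  rewrite sumE ler_norml => h /andP[r0 r1] /andP[v0 v1].
  have := ler_wpM2r h r1; have := mulr_ge0 r0 h; rewrite mul1r => *.
  by apply/andP; split; lra.
apply/eqP; rewrite -subr_eq0 -normr_le0; apply/ler_addgt0Pr => e e0; rewrite add0r.
by have [K] := exp2V_small e0; exact: le_trans.
Qed.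

End Cylindrical.

(** * Coding of bounded complex sequences by bits, and their realization on a set *)

Section Coding.
Local Open Scope complex_scope.
Variable R : realType.
Local Notation C := R[i].

Definition cpart (im : bool) (z : C) : R :=
  if im then complex.Im z else complex.Re z.

(** Here [c] is a coordinate with a flag for its real or imaginary part. Pairing it with [k] gives
    each part its own infinite set of bits, and the affine map carries [0, 1] to [-1, 1]. *)
Definition decode (c : nat * bool) (b : nat -> bool) : R :=
  2 * binary_value R (fun k => b (pickle (c, k))) - 1.

Definition encode (w : nat -> C) (m : nat) : bool :=
  if unpickle m is Some (c, k)
  then binary_digit ((cpart c.2 (w c.1) + 1) / 2) k else false.

Lemma decode_encode w c : csq (w c.1) <= 1 -> decode c (encode w) = cpart c.2 (w c.1).
Proof.
move=> w1; have p1 : `|cpart c.2 (w c.1)| <= 1.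
  rewrite -(ler_sqr (normr_ge0 _) ler01) expr1n real_normK ?num_real //.
  apply: le_trans w1; rewrite /csq /cpart; case: c.2.
    by rewrite lerDr sqr_ge0.
  by rewrite lerDl sqr_ge0.
rewrite /decode (_ : (fun k => _) = binary_digit ((cpart c.2 (w c.1) + 1) / 2)).
  rewrite binary_value_digit; first by field.
  by move: p1; rewrite ler_norml => /andP[? ?]; apply/andP; split; lra.
by apply/funext => k; rewrite /encode pickleK.
Qed.

Lemma decode_bound c b : `|decode c b| <= 1.
Proof.
have := @binary_value_bounds R (fun k => b (pickle (c, k))) 0.
rewrite /binary_sum big_geq // expr0 invr1 add0r /decode ler_norml => /andP[? ?].
by apply/andP; split; lra.
Qed.

Lemma cylindrical_decode c : cylindrical (decode c).
Proof.
split; first by exists 1 => b; exact: decode_bound.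
move=> e e0; have e2 : 0 < e / 2 by rewrite divr_gt0.
have [K Ke] := exp2V_small e2.
(* All bits used by the first [K] digits have positions below [M]; the reversal of prefixes turns
   position [p] into index [M.-1 - p]. *)
pose M := \max_(k < K) (pickle (c, (k : nat))).+1.
exists M, (fun s => 2 * (\sum_(0 <= k < K)
  (nth false s (M.-1 - pickle (c, k)))%:R / 2 ^+ k.+1) - 1) => b.
have -> : \sum_(0 <= k < K)
    (nth false (prefix_bits b M) (M.-1 - pickle (c, k)))%:R / 2 ^+ k.+1 =
    binary_sum R (fun k => b (pickle (c, k))) K.
  apply: eq_big_nat => k /andP[_ kK]; rewrite nth_prefix_bits //.
  exact: (leq_bigmax (F := fun k : 'I_K => (pickle (c, (k : nat))).+1) (Ordinal kK)).
have := @binary_value_bounds R (fun k => b (pickle (c, k))) K.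
by rewrite /decode ler_norml => /andP[? ?]; apply/andP; split; lra.
Qed.

(** The laws for the first [n] indices, with entry errors below [1 / n.+1], are turned into laws of
    bits and passed to the limit. Products of decoded parts are cylindrical, so the Gram identities
    become exact. *)
Theorem bounded_realization d (T : measurableType d) (mu : {measure set T -> \bar R})
    (F : set T) (delta : R) (g : nat -> nat -> C) :
  measurable F -> mu F = delta%:E -> divisible mu F -> 0 < delta ->
  (forall j k, g k j = (g j k)^*) ->
  (forall n (c : 'I_n -> C), 0 <= complex.Re (\sum_j \sum_k c j * (c k)^* * g j k)
     <= \sum_j csq (c j)) ->
  exists w : nat -> T -> C,
  [/\ forall j, measurable_fun F (fun x => complex.Re (w j x)) /\
        measurable_fun F (fun x => complex.Im (w j x)),
      forall j x, `|complex.Re (w j x)| <= 1 /\ `|complex.Im (w j x)| <= 1,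
      forall j, {ae mu, forall x, F x -> csq (w j x) <= 1} &
      forall j k,
        \int[mu]_(x in F) complex.Re (w j x * (w k x)^* ) =
           delta * complex.Re ((j == k)%:R - g j k) /\
        \int[mu]_(x in F) complex.Im (w j x * (w k x)^* ) =
           delta * complex.Im ((j == k)%:R - g j k)].
Proof.
move=> mF muF divF delta0 gherm gbnd.
have inv0 n : 0 < (n.+1%:R^-1 : R) ^+ 2 by rewrite exprn_gt0 // invr_gt0.
pose good n (L : {I : finType & ((I -> R) * (I -> nat -> C))%type}) :=
  let p := (projT2 L).1 in let w := (projT2 L).2 in
  [/\ forall i, 0 <= p i, \sum_i p i = 1, forall i j, csq (w i j) <= 1 &
    forall j k, (j < n)%N -> (k < n)%N ->
      csq (\sum_i (p i)%:C * (w i j * (w i k)^*) - ((j == k)%:R - g j k)) <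
      n.+1%:R^-1 ^+ 2].
have exL n : exists L, good n L.
  have [I [p [w h]]] := gram_discrete_law gherm (gbnd n) (inv0 n).
  by exists (existT _ I (p, w)).
have [L LP] := choice exL.
pose I n := projT1 (L n); pose p n : I n -> R := (projT2 (L n)).1.
pose w n : I n -> nat -> C := (projT2 (L n)).2.
have p0 n i : 0 <= p n i by have [h _ _ _] := LP n; exact: h.
have p1 n : \sum_i p n i = 1 by have [_ h _ _] := LP n; exact: h.
have w1 n i j : csq (w n i j) <= 1 by have [_ _ h _] := LP n; exact: h.
have wg n j k : (j < n)%N -> (k < n)%N ->
    csq (\sum_i (p n i)%:C * (w n i j * (w n i k)^*) - ((j == k)%:R - g j k)) <
    n.+1%:R^-1 ^+ 2 by have [_ _ _] := LP n; apply.
have decE n i c : decode c (encode (w n i)) = cpart c.2 (w n i c.1).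
  by rewrite decode_encode.
have [b bP] := @random_bits_limit _ _ _ mu F delta I p (fun n i => encode (w n i))
  mF muF divF delta0 p0 p1.
pose D c x := decode c (b^~ x).
(* Common to real and imaginary parts: a part respects differences and is dominated by the modulus,
   so it converges along with the complex entry. *)
have cvg_part (part : C -> R) (j k : nat) (E : nat -> R) :
    (forall x y, part (x - y) = part x - part y) ->
    (forall z, part z ^+ 2 <= csq z) ->
    (forall n, E n = part (\sum_i (p n i)%:C * (w n i j * (w n i k)^*))) ->
    E @ \oo --> part ((j == k)%:R - g j k).
  move=> partB part_le EE; apply/cvgrPdist_le => /= e e0; near=> n.
  rewrite distrC EE -partB.
  have nj : (j < n)%N by near: n; exists j.+1.
  have nk : (k < n)%N by near: n; exists k.+1.
  apply: (@le_trans _ _ n.+1%:R^-1).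
    rewrite -ler_sqr ?nnegrE ?invr_ge0 // real_normK ?num_real //.
    by apply: le_trans (part_le _) _; exact/ltW/wg.
  by apply: ltW; near: n; exact: (near_infty_natSinv_lt (PosNum e0)).
exists (fun j x => Complex (D (j, false) x) (D (j, true) x)); split.
- move=> j; split => /=.
    by have [] := bP _ (cylindrical_decode (j, false)).
  by have [] := bP _ (cylindrical_decode (j, true)).
- by move=> j x; split; exact: decode_bound.
- move=> j.
  (* The excess of the squared modulus over one is cylindrical and vanishes under every finite law,
     so its integral over [F] is zero and it vanishes almost everywhere there. *)
  pose Phi b' := Num.max 0 (decode (j, false) b' * decode (j, false) b' +
    (decode (j, true) b' * decode (j, true) b' + -1)).
  have cPhi : cylindrical Phi.
    apply: cylindrical_max0; apply: cylindricalD.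
      by apply: cylindricalM; exact: cylindrical_decode.
    apply: cylindricalD; last exact: cylindrical_cst.
    by apply: cylindricalM; exact: cylindrical_decode.
  have [mPhi intPhi] := bP _ cPhi.
  have [[B PhiB] _] := cPhi.
  have iPhi : mu.-integrable F (EFin \o (fun x => Phi (b^~ x))).
    exact: (bounded_integrable_fin mF muF mPhi (fun x _ => PhiB _)).
  have : \int[mu]_(x in F) Phi (b^~ x) = 0.
    rewrite (intPhi 0) ?mulr0 //; apply: cvg_near_cst; apply: nearW => n.
    rewrite big1 // => i _; rewrite /Phi !decE /= -!expr2 addrA -/(csq _).
    rewrite max_l ?mulr0 // subr_le0; exact: w1.
  move=> int0.
  have : (\int[mu]_(x in F) `|(Phi (b^~ x))%:E| = 0)%E.
    rewrite (eq_integral (fun x => (Phi (b^~ x))%:E)); last first.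
      by move=> x _; rewrite gee0_abs // lee_fin le_max lexx.
    by rewrite -[LHS]fineK ?[fine _]int0 //; exact: integrable_fin_num iPhi.
  move/ae_eq_integral_abs => /(_ mF) ae0.
  have {}ae0 := ae0 (proj2 (measurable_EFinP _ _) mPhi).
  apply: filterS ae0 => x /= Phi0 Fx; have /eqP := Phi0 Fx.
  rewrite eqe /Phi => /eqP h; rewrite -subr_le0 /csq /= -addrA !expr2.
  by rewrite -[leRHS]h le_max lexx orbT.
move=> j k; split.
- pose Phi b' := decode (j, false) b' * decode (k, false) b' +
    decode (j, true) b' * decode (k, true) b'.
  have cPhi : cylindrical Phi.
    by apply: cylindricalD; apply: cylindricalM; exact: cylindrical_decode.
  have [_ <-] := bP _ cPhi; first by apply: eq_Rintegral => x _ /=; rewrite mulrN opprK.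
  apply: (cvg_part (@complex.Re R)) => [x y|z|n].
  + by rewrite -[in RHS]mulN1r; case: x; case: y => /= *; ring.
  + by rewrite /csq lerDl sqr_ge0.
  + rewrite Re_sum; apply: eq_bigr => i _; rewrite /Phi !decE /cpart /=.
    by case: (w n i j) (w n i k) => [a1 a2] [b1 b2] /=; ring.
- pose Phi b' := decode (j, true) b' * decode (k, false) b' +
    -1 * (decode (j, false) b' * decode (k, true) b').
  have cPhi : cylindrical Phi.
    apply: cylindricalD; first by apply: cylindricalM; exact: cylindrical_decode.
    apply: cylindricalM; first exact: cylindrical_cst.
    by apply: cylindricalM; exact: cylindrical_decode.
  have [_ <-] := bP _ cPhi.
    by apply: eq_Rintegral => x _ /=; rewrite /Phi /D; ring.
  apply: (cvg_part (@complex.Im R)) => [x y|z|n].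
  + by case: x; case: y => /= *; ring.
  + by rewrite /csq lerDr sqr_ge0.
  + rewrite Im_sum; apply: eq_bigr => i _; rewrite /Phi !decE /cpart /=.
    by case: (w n i j) (w n i k) => [a1 a2] [b1 b2] /=; ring.
Unshelve. all: by end_near. Qed.

End Coding.

(** * Lebesgue measure on the unit interval *)

Section Lebesgue.
Local Open Scope complex_scope.
Variable R : realType.
Local Notation T := (lebesgueType R).
Local Notation mu := (@completed_lebesgue_measure R).

Lemma measurable_interval (i : interval R) : @measurable _ T [set` i].
Proof. by apply: sub_caratheodory; exact: measurable_itv. Qed.

Lemma lambda_interval (i : interval R) :
  mu [set` i] = (if i.1 < i.2 then (i.2 : \bar R) - i.1 else 0)%E.
Proof. exact: lebesgue_measure_itv. Qed.

Lemma lambda_unit_itv : mu (@unit_itv R) = 1%E.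
Proof. by rewrite /unit_itv lambda_interval /= lte_fin ltr01 oppr0 adde0. Qed.

Lemma measurable_unit_itv : measurable (@unit_itv R).
Proof. exact: measurable_interval. Qed.

(* The measure of [A] below [x] is a Lipschitz function of [x]. *)
Lemma divisible_unit_itv (F : set T) : F `<=` @unit_itv R -> divisible mu F.
Proof.
move=> F01 A mA AF q q0 qA.
have A01 : A `<=` @unit_itv R by exact: subset_trans F01.
pose Ax (x : R) : set T := A `&` [set` `[0 : R, x]].
have mAx x : measurable (Ax x) by apply: measurableI => //; exact: measurable_interval.
have muA : (mu A <= 1)%E.
  by rewrite -lambda_unit_itv le_measure ?inE //; exact: measurable_unit_itv.
have finAx x : mu (Ax x) \is a fin_num.
  rewrite ge0_fin_numE //; apply: le_lt_trans (ltry 1); apply: le_trans muA.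
  by apply: measureIl => //; exact: measurable_interval.
pose h x := fine (mu (Ax x)).
have hE x : mu (Ax x) = (h x)%:E by rewrite /h fineK.
have hmono x y : x <= y -> h x <= h y.
  move=> xy; rewrite -lee_fin -!hE le_measure ?inE // => z [Az zx]; split=> //.
  by move: zx => /=; rewrite !in_itv /= => /andP[-> /= /le_trans]; apply.
have hlip x y : x <= y -> h y <= h x + (y - x).
  move=> xy; rewrite -lee_fin EFinD -!hE.
  have -> : ((y - x)%:E = mu [set` `]x, y]])%E.
    rewrite lambda_interval /= lte_fin; case: ltP => [//|yx].
    by rewrite (le_anti (_ : x <= y <= x)) ?subrr // xy.
  apply: le_trans (measureU2 _ _ _); [|exact: mAx|exact: measurable_interval].
  rewrite le_measure ?inE //; first by apply: measurableU => //; exact: measurable_interval.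
  move=> z [Az]; rewrite /= !in_itv /= => /andP[z0 zy].
  have [zx|xz] := leP z x; first by left; split=> //=; rewrite in_itv /= z0 zx.
  by right.
have hcont : continuous h.
  move=> x; apply/cvgrPdist_le => /= e e0; near=> y.
  have : `|x - y| <= e by near: y; exact: cvgr_dist_le.
  have [xy|/ltW yx] := leP x y.
    by have := hmono _ _ xy; have := hlip _ _ xy => ? ?;
      rewrite ler0_norm ?ler0_norm; lra.
  by have := hmono _ _ yx; have := hlip _ _ yx => ? ?;
    rewrite ger0_norm ?ger0_norm; lra.
have h0 : h 0 = 0.
  apply/eqP; rewrite eq_le fine_ge0 // andbT -lee_fin -hE.
  have -> : (0 : R)%:E = mu [set` `[(0 : R), (0 : R)]] by rewrite lambda_interval /= lte_fin ltxx.
  apply: measureIr => //; exact: measurable_interval.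
have h1 : mu A = (h 1)%:E by rewrite -hE /Ax setIidl.
have h10 : 0 <= h 1 by rewrite fine_ge0.
(* [h] runs continuously from 0 to the measure of [A], so some cut [Ax c] has measure [q]. *)
have [|c _ hc] := @IVT R h 0 1 q ler01 (continuous_subspaceT hcont).
  by rewrite h0 min_l // max_r // q0 -lee_fin -h1.
exists (Ax c); split=> //; first by move=> x [].
by apply: etrans (hE c) _; rewrite hc.
Unshelve. all: by end_near. Qed.

End Lebesgue.

(** * Square integrable functions *)

Section L2.
Local Open Scope complex_scope.
Context d (T : measurableType d) (R : realType) (mu : {measure set T -> \bar R}).
Variables (D : set T) (mD : measurable D).
Local Notation C := R[i].
Implicit Types f g : T -> C.

Lemma cmod_sqr (z : C) : cmod z ^+ 2 = csq z.
Proof. by case: z => a b; rewrite /csq /= sqr_sqrtr // addr_ge0 // sqr_ge0. Qed.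

Lemma cmod_ge0 (z : C) : 0 <= cmod z.
Proof. by case: z => a b; exact: sqrtr_ge0. Qed.

Lemma Lnorm2_sqr f :
  ('N[mu]_(2%:E)[(fun x => (cmod (f x))%:E) \_ D] ^+ 2 =
   \int[mu]_(x in D) (csq (f x))%:E)%E.
Proof.
have e2 (e : \bar R) : (0 <= e)%E -> (e ^+ 2 = e `^ 2)%E.
  case: e => [r r0| |//]; last by rewrite poweRyr // expe2 mulyy.
  by rewrite poweR_EFin powR_mulrn // EFin_expe.
rewrite e2 ?Lnorm_ge0 // powR_Lnorm // [RHS]integral_mkcond.
apply: eq_integral => x _; rewrite !patchE; case: ifPn => _.
  by rewrite -e2 ?abse_ge0 // abse_EFin -EFin_expe -cmod_sqr real_normK ?num_real.
by rewrite abse0 -e2 // expe2 mule0.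
Qed.

Lemma Lnorm2_lty f :
  ('N[mu]_(2%:E)[(fun x => (cmod (f x))%:E) \_ D] < +oo)%E <->
  (\int[mu]_(x in D) (csq (f x))%:E < +oo)%E.
Proof.
rewrite -Lnorm2_sqr; have : (0 <= 'N[mu]_(2%:E)[(fun x => (cmod (f x))%:E) \_ D])%E.
  exact: Lnorm_ge0.
case: ('N[mu]_(2%:E)[_])%E => [r _| |//]; first by rewrite -EFin_expe !ltry.
by rewrite expe2 mulyy.
Qed.

Definition L2_on f := [/\ measurable_fun D (fun x => complex.Re (f x)),
  measurable_fun D (fun x => complex.Im (f x)) &
  (\int[mu]_(x in D) (csq (f x))%:E < +oo)%E].

Lemma measurable_csq f : measurable_fun D (fun x => complex.Re (f x)) ->
  measurable_fun D (fun x => complex.Im (f x)) ->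
  measurable_fun D (fun x => csq (f x)).
Proof.
by move=> mr mi; apply: measurable_funD; exact: measurable_funX.
Qed.

Lemma L2_integrable f : L2_on f -> mu.-integrable D (EFin \o (fun x => csq (f x))).
Proof.
move=> [mr mi foo]; apply/integrableP; split.
  by apply/measurable_EFinP; exact: measurable_csq.
rewrite (eq_integral (fun x => (csq (f x))%:E)) // => x _.
by rewrite gee0_abs // lee_fin csq_ge0.
Qed.

(** The product is dominated by the integrable |f|^2 + |g|^2; [a] and [b] stand for real or
    imaginary parts. *)
Lemma L2_mul_integrable f g (a b : T -> R) : L2_on f -> L2_on g ->
  measurable_fun D a -> measurable_fun D b ->
  (forall x, a x ^+ 2 <= csq (f x)) -> (forall x, b x ^+ 2 <= csq (g x)) ->
  mu.-integrable D (EFin \o (fun x => a x * b x)).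
Proof.
move=> Lf Lg ma mb af bg.
apply: (le_integrable mD _ _ (integrableD mD (L2_integrable Lf) (L2_integrable Lg))).
  by apply/measurable_EFinP; exact: measurable_funM.
move=> x Dx /=; rewrite lee_fin (ger0_norm (addr_ge0 (csq_ge0 (f x)) (csq_ge0 (g x)))).
apply: (le_trans _ (lerD (af x) (bg x))).
have := sqr_ge0 (`|a x| - `|b x|); rewrite sqrrB !real_normK ?num_real // normrM.
have := mulr_ge0 (normr_ge0 (a x)) (normr_ge0 (b x)); rewrite -mulr_natr; lra.
Qed.

Lemma L2_inner_integrable f g : L2_on f -> L2_on g ->
  mu.-integrable D (EFin \o (fun x => complex.Re (f x * (g x)^*))) /\
  mu.-integrable D (EFin \o (fun x => complex.Im (f x * (g x)^*))).
Proof.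
move=> Lf Lg; have [rf if_ _] := Lf; have [rg ig _] := Lg.
have re (z : C) : complex.Re z ^+ 2 <= csq z by rewrite lerDl sqr_ge0.
have im (z : C) : complex.Im z ^+ 2 <= csq z by rewrite lerDr sqr_ge0.
split.
  rewrite (_ : _ \o _ = (fun x => (complex.Re (f x) * complex.Re (g x))%:E +
    (complex.Im (f x) * complex.Im (g x))%:E)%E); last first.
    apply/funext => x /=; rewrite -EFinD; congr (_%:E).
    by case: (f x) (g x) => [a b] [a' b'] /=; ring.
  by apply: integrableD => //; apply: L2_mul_integrable Lf Lg _ _ _ _.
rewrite (_ : _ \o _ = (fun x => (complex.Im (f x) * complex.Re (g x))%:E -
    (complex.Re (f x) * complex.Im (g x))%:E)%E); last first.
  apply/funext => x /=; rewrite -EFinB; congr (_%:E).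
  by case: (f x) (g x) => [a b] [a' b'] /=; ring.
by apply: integrableB => //; apply: L2_mul_integrable Lf Lg _ _ _ _.
Qed.

Definition gram f g : C := Complex (\int[mu]_(x in D) complex.Re (f x * (g x)^*))
  (\int[mu]_(x in D) complex.Im (f x * (g x)^*)).

Lemma gram_herm f g : L2_on f -> L2_on g -> gram g f = (gram f g)^*.
Proof.
move=> Lf Lg; rewrite /gram /=; congr Complex.
  apply: eq_Rintegral => x _.
  by case: (f x) (g x) => [a b] [a' b'] /=; ring.
have [_ iI] := L2_inner_integrable Lf Lg.
rewrite -mulN1r -RintegralZl //; apply: eq_Rintegral => x _.
by case: (f x) (g x) => [a b] [a' b'] /=; ring.
Qed.

(** Write the squared modulus of the sum as the real part of the sum times its conjugate, expand,
    and integrate term by term. *)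
Lemma gram_quadratic n (u : 'I_n -> T -> C) (c : 'I_n -> C) :
  (forall j, L2_on (u j)) ->
  complex.Re (\sum_j \sum_k c j * (c k)^* * gram (u j) (u k)) =
  \int[mu]_(x in D) csq (\sum_j c j * u j x).
Proof.
move=> Lu.
pose r j k := complex.Re (c j * (c k)^*); pose s j k := complex.Im (c j * (c k)^*).
pose U j k x := r j k * complex.Re (u j x * (u k x)^*) -
  s j k * complex.Im (u j x * (u k x)^*).
have iU j k : mu.-integrable D (EFin \o U j k).
  have [iR iI] := L2_inner_integrable (Lu j) (Lu k).
  by apply: (integrableB mD (integrableZl mD (r j k) iR) (integrableZl mD (s j k) iI)).
rewrite (@eq_Rintegral _ _ _ _ D (fun x => \sum_j \sum_k U j k x)); last first.
  move=> x _.
  have -> : csq (\sum_j c j * u j x) =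
      complex.Re ((\sum_j c j * u j x) * (\sum_j c j * u j x)^*).
    by case: (\sum_j _) => a b; rewrite /csq /=; ring.
  rewrite rmorph_sum mulr_suml Re_sum; apply: eq_bigr => j _.
  rewrite mulr_sumr Re_sum; apply: eq_bigr => k _.
  rewrite rmorphM /U /r /s.
  by case: (c j) (c k) (u j x) (u k x) => [? ?] [? ?] [? ?] [? ?] /=; ring.
rewrite Rintegral_sum // => [|j]; last first.
  rewrite (_ : _ \o _ = (fun x => \sum_k (U j k x)%:E)%E).
    by apply: integrable_sum => // k _; exact: iU.
  by apply/funext => x /=; rewrite sumEFin.
rewrite Re_sum; apply: eq_bigr => j _.
rewrite Rintegral_sum // Re_sum; apply: eq_bigr => k _.
have [iR iI] := L2_inner_integrable (Lu j) (Lu k).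
rewrite /U RintegralB //; last 2 first.
- exact: (integrableZl mD (r j k) iR).
- exact: (integrableZl mD (s j k) iI).
rewrite !RintegralZl // /r /s /gram.
by case: (c j * _) => a b.
Qed.

Lemma L2_bounded f (B : R) : (mu D < +oo)%E ->
  measurable_fun D (fun x => complex.Re (f x)) ->
  measurable_fun D (fun x => complex.Im (f x)) ->
  (forall x, D x -> csq (f x) <= B) -> L2_on f.
Proof.
move=> muD mr mi fB; split => //.
have muDE : mu D = (fine (mu D))%:E by rewrite fineK // ge0_fin_numE.
have fB' x : D x -> `|csq (f x)| <= B by move=> Dx; rewrite ger0_norm ?csq_ge0 // fB.
have /integrableP[_] := bounded_integrable_fin mD muDE (measurable_csq mr mi) fB'.
rewrite (eq_integral (fun x => (csq (f x))%:E)) // => x _ /=.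
by rewrite ger0_norm // csq_ge0.
Qed.

Lemma eq_L2 f g : {in D, f =1 g} -> L2_on f -> L2_on g.
Proof.
move=> fg [mr mi foo]; split.
- by apply: eq_measurable_fun mr => x Dx; rewrite fg.
- by apply: eq_measurable_fun mi => x Dx; rewrite fg.
rewrite (eq_integral (fun x => (csq (f x))%:E)) // => x Dx.
by rewrite fg.
Qed.

Lemma eq_gram f f' g g' : {in D, f =1 f'} -> {in D, g =1 g'} ->
  gram f g = gram f' g'.
Proof.
move=> ff gg; congr Complex; apply: eq_Rintegral => x Dx; by rewrite ff // gg.
Qed.

Lemma L2Z f (s : R) : L2_on f -> L2_on (fun x => s%:C * f x).
Proof.
move=> Lf; have [mr mi _] := Lf; split.
- rewrite (_ : (fun x => _) = (fun x => s * complex.Re (f x))).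
    exact: measurable_funM.
  by apply/funext => x; case: (f x) => a b /=; rewrite mul0r subr0.
- rewrite (_ : (fun x => _) = (fun x => s * complex.Im (f x))).
    exact: measurable_funM.
  by apply/funext => x; case: (f x) => a b /=; rewrite mul0r addr0.
have iZ := integrableZl mD (s ^+ 2) (L2_integrable Lf).
rewrite (eq_integral (fun x => (s ^+ 2)%:E * (csq (f x))%:E)%E); last first.
  by move=> x _; rewrite -EFinM csqZ.
by rewrite -ge0_fin_numE; [exact: integrable_fin_num iZ|
  apply: integral_ge0 => x _; rewrite -EFinM lee_fin mulr_ge0 ?csq_ge0 ?sqr_ge0].
Qed.

Lemma gramZ f g (s : R) : L2_on f -> L2_on g ->
  gram (fun x => s%:C * f x) (fun x => s%:C * g x) = (s ^+ 2)%:C * gram f g.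
Proof.
move=> Lf Lg; have [iR iI] := L2_inner_integrable Lf Lg.
have mulC (a b : R) : (s ^+ 2)%:C * Complex a b = Complex (s ^+ 2 * a) (s ^+ 2 * b).
  by apply/eqP; rewrite eq_complex /= !mul0r subr0 addr0 !eqxx.
rewrite /gram mulC -!RintegralZl //.
congr Complex; apply: eq_Rintegral => x _;
  by case: (f x) (g x) => [a b] [a' b'] /=; ring.
Qed.

End L2.

Section L2Union.
Local Open Scope complex_scope.
Context d (T : measurableType d) (R : realType) (mu : {measure set T -> \bar R}).
Variables (A B : set T) (mA : measurable A) (mB : measurable B).
Hypothesis AB : [disjoint A & B].
Implicit Types f g : T -> R[i].

Lemma L2_union f : L2_on mu A f -> L2_on mu B f -> L2_on mu (A `|` B) f.
Proof.
move=> [rA iA fA] [rB iB fB].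
have mr : measurable_fun (A `|` B) (fun x => complex.Re (f x)).
  by apply/measurable_funU.
have mi : measurable_fun (A `|` B) (fun x => complex.Im (f x)).
  by apply/measurable_funU.
split=> //; rewrite ge0_integral_setU //.
- by rewrite lte_add_pinfty.
- by apply/measurable_EFinP; apply: measurable_csq => //; exact: measurableU.
- by move=> x _; rewrite lee_fin csq_ge0.
Qed.

Lemma gram_union f g : L2_on mu (A `|` B) f -> L2_on mu (A `|` B) g ->
  gram mu (A `|` B) f g = gram mu A f g + gram mu B f g.
Proof.
move=> Lf Lg; have [iR iI] := L2_inner_integrable (measurableU _ _ mA mB) Lf Lg.
by rewrite /gram !Rintegral_setU.
Qed.

End L2Union.

(** * Completion of Bessel sequences *)

Section Completion.
Variable R : realType.
Local Notation T := (lebesgueType R).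
Local Notation mu := (@completed_lebesgue_measure R).
Implicit Types (D E F : set T) (f g : T -> R[i]).

Lemma inL2P D f : inL2 D f <-> L2_on mu D f.
Proof.
split=> [[[mr mi] foo]|[mr mi foo]]; first by split => //; exact/Lnorm2_lty.
by split; [split|exact/Lnorm2_lty].
Qed.

(** By [gram_quadratic] the form of the Gram matrix is a squared norm, so the Bessel inequality
    places it between 0 and the identity, as [bounded_realization] requires. *)
Lemma bessel1_gram E (u : nat -> T -> R[i]) : measurable E -> bessel1 E u ->
  forall n (c : 'I_n -> R[i]),
    0 <= complex.Re (\sum_j \sum_k c j * (conjc (c k)) * gram mu E (u j) (u k))
      <= \sum_j csq (c j).
Proof.
move=> mE [uL2 ubnd] n c.
rewrite (gram_quadratic mE) => [|j]; last exact/inL2P/uL2.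
rewrite Rintegral_ge0 => [|x _]; last exact: csq_ge0.
have := ubnd n c; rewrite /Lpnorm Lnorm2_sqr => h.
rewrite /= -lee_fin /Rintegral fineK.
  by apply: le_trans h _; rewrite lee_fin; apply: ler_sum => j _; rewrite cmod_sqr.
rewrite ge0_fin_numE; first exact: le_lt_trans h (ltry _).
by apply: integral_ge0 => x _; rewrite lee_fin csq_ge0.
Qed.

(** Off [D] the function is extended by zero, where the bound reads [0 <= C]; positive total measure
    selects the essential supremum in the definition of the norm. *)
Lemma Lpnorm_pinftyP D f (C : R) : 0 <= C -> (0 < mu setT)%E ->
  (Lpnorm D +oo f <= C%:E)%E <-> {ae mu, forall x, D x -> cmod (f x) <= C}.
Proof.
move=> C0 muT; rewrite /Lpnorm unlock muT.
have absE x : ((abse \o ((fun x => (cmod (f x))%:E) \_ D)) x <= C%:E)%E <->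
    (D x -> cmod (f x) <= C).
  rewrite /= patchE; case: ifPn => [/set_mem Dx|/negP nDx].
    rewrite abse_EFin lee_fin ger0_norm; first by split=> // /(_ Dx).
    exact: cmod_ge0.
  by rewrite abse0 lee_fin C0; split=> // _ Dx; case: nDx; exact/mem_set.
split=> [/ess_supP|h]; first by apply: filterS => x /absE.
by apply/ess_supP; apply: filterS h => x /absE.
Qed.

End Completion.

(** * Gluing on the two pieces of the interval, and the zero sequence as extremal case *)

Theorem theorem1p2 (R : realType) (E : set (lebesgueType R))
    (measE : measurable E) (subE : E `<=` @unit_itv R)
    (posF : (0 < lambda (@unit_itv R `\` E))%E) :
  completion_with_bound E
    (1 / Num.sqrt (fine (lambda (@unit_itv R `\` E)))) /\
  (forall C : R, C < 1 / Num.sqrt (fine (lambda (@unit_itv R `\` E))) ->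
    ~ completion_with_bound E C).
Proof.
set F := @unit_itv R `\` E in posF *.
set delta := fine (lambda F).
have mF : measurable F by apply: measurableD => //; exact: measurable_unit_itv.
have F01 : F `<=` @unit_itv R by move=> x [].
have FE : @unit_itv R = E `|` F by rewrite /F setDUK.
have EF : [disjoint E & F] by apply/disj_setPS => x [Ex [_ /(_ Ex)]].
have muF : lambda F = delta%:E.
  rewrite /delta fineK // ge0_fin_numE //; apply: (@le_lt_trans _ _ 1%E); last exact: ltry.
  by rewrite -(lambda_unit_itv R) le_measure ?inE //; exact: measurable_unit_itv.
have Foo : (lambda F < +oo)%E by rewrite muF ltry.
have delta0 : 0 < delta by rewrite -lte_fin -muF.
have muT : (0 < lambda [set: lebesgueType R])%E.
  by apply: lt_le_trans posF _; rewrite le_measure ?inE.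
set s := 1 / Num.sqrt delta.
have sd : s ^+ 2 * delta = 1.
  by rewrite /s div1r exprVn sqr_sqrtr ?mulVf ?gt_eqF // ltW.
have s0 : 0 < s by rewrite /s divr_gt0 // sqrtr_gt0.
split.
  move=> u bu; have [uL2 _] := bu.
  have Lu j : L2_on lambda E (u j) by exact/inL2P.
  have [w [mw wb w1 wg]] := bounded_realization mF muF (divisible_unit_itv F01) delta0
    (fun j k => gram_herm measE (Lu j) (Lu k)) (bessel1_gram measE bu).
  (* Since [s ^+ 2 * delta = 1], the factor [s] turns the Gram matrix of [w], which is [delta] times
     1 - Gram, into 1 - Gram. *)
  pose v j x : R[i] := real_complex R s * w j x.
  pose phi j x : R[i] := if x \in E then u j x else v j x.
  have phiE j : {in E, phi j =1 u j} by move=> x xE; rewrite /phi xE.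
  have phiF j : {in F, phi j =1 v j}.
    by move=> x /set_mem[_ nE]; rewrite /phi memNset.
  (* The bound 2 comes from both parts being at most one everywhere; the sharper bound [w1] holds
     only almost everywhere. *)
  have Lw j : L2_on lambda F (w j).
    have [mr mi] := mw j; apply: (@L2_bounded _ _ _ _ _ mF (w j) 2) => // x _.
    have [wr wi] := wb j x; rewrite /csq -(real_normK (num_real (complex.Re _))).
    rewrite -(real_normK (num_real (complex.Im _))).
    have := exprn_ile1 2 (normr_ge0 _) wr; have := exprn_ile1 2 (normr_ge0 _) wi; lra.
  have Lv j : L2_on lambda F (v j) by exact: L2Z.
  have Lphi j : L2_on lambda (E `|` F) (phi j).
    apply: (L2_union measE mF EF).
      by apply: eq_L2 (Lu j) => x xE; rewrite phiE.
    by apply: eq_L2 (Lv j) => x xF; rewrite phiF.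
  exists phi; split; [split|split].
  - by move=> j; apply/inL2P; rewrite FE.
  - move=> j k.
    have -> : inner (@unit_itv R) (phi j) (phi k) = gram lambda (E `|` F) (phi j) (phi k).
      by rewrite FE.
    (* On [E] the Gram matrix is that of [u], and on [F] it is the complement to the identity. *)
    rewrite (gram_union measE mF EF (Lphi j) (Lphi k)) (eq_gram _ (phiE j) (phiE k)).
    rewrite (eq_gram _ (phiF j) (phiF k)).
    rewrite (gramZ mF s (Lw j) (Lw k)) -[gram lambda F _ _]/(Complex _ _).
    have [-> ->] := wg j k; set z := (X in complex.Re X).
    have -> : real_complex R (s ^+ 2) * Complex (delta * complex.Re z)
        (delta * complex.Im z) = z.
      apply/eqP; rewrite eq_complex /= !mul0r subr0 addr0 !mulrA sd !mul1r.
      by rewrite !eqxx.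
    by rewrite /z addrC subrK.
  - move=> j; apply: aeW => x Ex; apply: phiE; exact: mem_set.
  - move=> j; apply/Lpnorm_pinftyP => //; first exact: ltW.
    apply: filterS (w1 j) => x wx Fx; rewrite phiF; last exact: mem_set.
    rewrite -ler_sqr ?nnegrE ?cmod_ge0 ?(ltW s0) // cmod_sqr csqZ.
    by rewrite ler_piMr ?sqr_ge0 // wx.
move=> C Cs comp.
have csq0 : csq (0 : R[i]) = 0 by rewrite /csq /= expr0n addr0.
(* For the zero sequence all the mass of [phi 0] has to lie on [F]. *)
have u0 : bessel1 E (fun _ _ => 0 : R[i]).
  split=> [j|n c].
    apply/inL2P; apply: (@L2_bounded _ _ _ _ _ measE _ 0) => // [|x _]; last by rewrite csq0.
    apply: le_lt_trans (ltry 1); rewrite -(lambda_unit_itv R) le_measure ?inE //.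
    exact: measurable_unit_itv.
  rewrite /Lpnorm Lnorm2_sqr integral0_eq => [|x _].
    by rewrite lee_fin sumr_ge0 // => j _; rewrite sqr_ge0.
  by rewrite big1 ?csq0 // => j _; rewrite mulr0.
have [phi [[phiL2 phiO] [phiE phiF]]] := comp _ u0.
have C0 : 0 <= C by rewrite -lee_fin; apply: le_trans (phiF 0%N); exact: Lnorm_ge0.
have {}phiF := (Lpnorm_pinftyP _ _ C0 muT).1 (phiF 0%N).
have Lphi : L2_on lambda (@unit_itv R) (phi 0%N) by exact/inL2P.
have int1 : (\int[lambda]_(x in @unit_itv R) (csq (phi 0%N x))%:E = 1%:E)%E.
  have [_ _ foo] := Lphi; have := congr1 (@complex.Re R) (phiO 0%N 0%N).
  rewrite eqxx /= => <-; rewrite /Rintegral.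
  rewrite (_ : (\int[lambda]_(x in _) (complex.Re _)%:E)%E =
      (\int[lambda]_(x in @unit_itv R) (csq (phi 0%N x))%:E)%E); last first.
    apply: eq_integral => x _; congr (_%:E).
    by case: (phi 0%N x) => a b; rewrite /csq /=; ring.
  rewrite fineK // ge0_fin_numE //.
  by apply: integral_ge0 => x _; rewrite lee_fin csq_ge0.
(* As |phi_0| <= C on [F] and phi_0 = 0 on [E], unit norm gives 1 <= C^2 delta, whereas C < s gives
   C^2 delta < s^2 delta = 1. *)
have : (1%:E <= \int[lambda]_(x in @unit_itv R) (C ^+ 2 * \1_F x)%:E)%E.
  rewrite -int1; apply: ae_ge0_le_integral.
  - exact: measurable_unit_itv.
  - by move=> x _; rewrite lee_fin csq_ge0.
  - by have [mr mi _] := Lphi; apply/measurable_EFinP; exact: measurable_csq.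
  - by move=> x _; rewrite lee_fin mulr_ge0 // sqr_ge0.
  - apply/measurable_EFinP; apply: measurable_funM => //; exact: measurable_indic.
  apply: filterS2 (phiE 0%N) phiF => x xE xF ux; rewrite lee_fin.
  have [Fx|nFx] := pselect (F x).
    rewrite indicE mem_set // mulr1 -cmod_sqr ler_sqr ?nnegrE ?cmod_ge0 //.
    exact: xF.
  rewrite indicE memNset // mulr0 xE ?csq0 //.
  by move: ux nFx; rewrite FE => -[].
under eq_integral do rewrite EFinM.
rewrite ge0_integralZl; last 4 first.
- exact: measurable_unit_itv.
- by apply/measurable_EFinP; exact: measurable_indic.
- by move=> x _; rewrite lee_fin.
- by rewrite lee_fin sqr_ge0.
rewrite integral_indic //; last exact: measurable_unit_itv.
rewrite setIidl // => h.
have : (1%:E <= (C ^+ 2)%:E * delta%:E)%E by rewrite -muF; exact: h.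
rewrite -EFinM lee_fin leNgt => /negP; apply.
rewrite -sd ltr_pM2r // ltr_sqr ?nnegrE //; exact: ltW.
Qed.
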